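(* Let $C,C',K,k\in\mathbb{N}$. Then there exist $R_0=R_0(C,C',k)\in\mathbb{N}$ and $R'=R'(C,K,k)\in\mathbb{N}$ such that the following holds. Let $X$ and $Y$ be non-empty, connected graphs, and write $d_X$ and $d_Y$ for their respective graph metrics. Suppose that $Y$ is $k$-simply connected and that $f:X\to Y$ satisfies the following conditions for some integer $R\ge R_0$: (i) for every pair of vertices $x\in X$ and $y\in Y$ with $d_Y(f(x),y)\le R'$, there exists $x'\in X$ such that $d_X(x,x')\le R/2$ and $d_Y(f(x'),y)\le K$; (ii) every pair of neighbours $x,x'$ in $X$ satisfies $d_Y(f(x),f(x'))\le C$; (iii) for every $x,x'\in X$ with $d_X(x,x')\le R$, if $d_Y(f(x),f(x'))\le C+2K$ then $d_X(x,x')\le C'$. Then $f$ is a $(\max\{C,C'/C\},\max\{C',K\})$-quasi-isometry and $X$ is $O_{C,C',k}(1)$-simply connected.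
   Context: $\mathbb{N}=\{1,2,\dots\}$. Maps between graphs are maps between their vertex sets. For $k\in\mathbb{N}$ and a graph $X$, $P_k(X)$ denotes the $2$-dimensional CW-complex whose $1$-skeleton is $X$ and whose $2$-cells are $m$-gons for $0\le m\le k$, attached along the simple loops $(x_0,\dots,x_m=x_0)$ of length $m$ in $X$ (one for each such loop up to cyclic permutation). The graph $X$ is $k$-simply connected if $P_k(X)$ is simply connected. For $A\ge1$, $B\ge0$, a map $f:X\to Y$ of metric spaces is an $(A,B)$-quasi-isometry if $A^{-1}d(x,y)-B\le d(f(x),f(y))\le Ad(x,y)+B$ for all $x,y\in X$ and every $y\in Y$ lies at distance at most $B$ from $f(X)$. ''$X$ is $O_{C,C',k}(1)$-simply connected'' means that $X$ is $\ell$-simply connected for some $\ell\in\mathbb{N}$ bounded above in terms of $C,C',k$ only. *)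

(* Defs.v *)
From HB Require Import structures.
From mathcomp Require Import all_boot all_order all_algebra.
From mathcomp Require Import all_classical all_reals.
From mathcomp Require Import topology normedtype trigo.

Set Implicit Arguments.
Unset Strict Implicit.
Unset Printing Implicit Defensive.

Import Order.TTheory GRing.Theory Num.Theory.
Import numFieldNormedType.Exports.

Local Open Scope classical_set_scope.
Local Open Scope ring_scope.

(* Simple graphs, possibly infinite and not locally finite. With the classical
   axioms of [boolp] every type is a [choiceType] and every relation is
   boolean, so neither is a restriction. *)
Record sgraph := SGraph {
  vertex :> choiceType;
  adj : rel vertex;
  adj_sym : symmetric adj;
  adj_irr : irreflexive adj
}.
Arguments adj {s}.

Section GraphMetric.
Variable X : sgraph.

Definition walk (x y : X) (n : nat) : Prop :=
  exists p : seq X, [/\ path adj x p, last x p = y & size p = n].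

Definition graph_connected : Prop := forall x y : X, exists n, walk x y n.

(* Junk value 0 when no walk joins x to y. *)
Definition gdist (x y : X) : nat :=
  xget 0%N [set n | walk x y n /\ forall m, walk x y m -> (n <= m)%N].

End GraphMetric.

Definition quasi_isometry (R : realType) (U V : Type)
    (dU : U -> U -> R) (dV : V -> V -> R) (A B : R) (f : U -> V) : Prop :=
  (forall x y, A^-1 * dU x y - B <= dV (f x) (f y) <= A * dU x y + B) /\
  (forall y, exists x, dV y (f x) <= B).

Definition simply_connected (R : realType) (T : topologicalType) : Prop :=
  (forall x y : T, exists g : R -> T,
     [/\ {within `[0, 1], continuous g}, g 0 = x & g 1 = y]) /\
  (forall g : R -> T, {within `[0, 1], continuous g} -> g 0 = g 1 ->
     exists H : R * R -> T,
       [/\ {within `[0, 1] `*` `[0, 1], continuous H},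
           forall s, 0 <= s <= 1 -> H (s, 0) = g s,
           forall s, 0 <= s <= 1 -> H (s, 1) = g 0 &
           forall t, 0 <= t <= 1 -> H (0, t) = g 0 /\ H (1, t) = g 0]).

Section PolygonalComplex.
Variables (R : realType) (k : nat) (X : sgraph).

(* The loop (x_0, x_1, ..., x_m = x_0) is encoded as (x_0, [:: x_1; ...; x_m]),
   so that m is the size of the second component. *)
Definition loop : Type := (X * seq X)%type.

Definition simple_loop (c : loop) : Prop :=
  [/\ path adj c.1 c.2, last c.1 c.2 = c.1 & uniq c.2].

Definition rot_loop (i : nat) (c : loop) : loop :=
  (last c.1 (rot i c.2), rot i c.2).

Definition loop_rep (c : loop) : loop :=
  xget c [set d | exists i, d = rot_loop i c].

(* One 2-cell for each simple loop of length at most k up to cyclic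
   permutation: the cell is indexed by the chosen representative of the class. *)
Definition face (c : loop) : Prop :=
  [/\ simple_loop c, (size c.2 <= k)%N & loop_rep c = c].

(* A point of the 1-skeleton is given by its barycentric coordinates, and a
   point of an open 2-cell by the cell and a point of the open unit disc. *)
Inductive cell_point :=
| GraphPoint of X -> R
| FacePoint of loop & R * R.

Definition segment_point (u v : X) (t : R) : cell_point :=
  GraphPoint (fun w => (1 - t) * (w == u)%:R + t * (w == v)%:R).

(* The attaching map of the 2-cell, with the unit circle parametrised by
   s |-> exp(2 i pi s): for s in [i/m, (i+1)/m] it runs along the edge from x_i
   to x_(i+1) at constant speed; it is constant when m = 0. *)
Definition attach (c : loop) (s : R) : cell_point :=
  let w := c.1 :: c.2 in
  let a := (size c.2)%:R * s in
  let i := Num.truncn a in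
  segment_point (nth c.1 w i) (nth c.1 w i.+1) (a - i%:R).

(* The characteristic map of the 2-cell, in polar coordinates (r, s) on the
   closed unit disc. *)
Definition face_map (c : loop) (rs : R * R) : cell_point :=
  if rs.1 < 1
  then FacePoint c (rs.1 * cos (2 * pi * rs.2), rs.1 * sin (2 * pi * rs.2))
  else attach c rs.2.

Definition is_cell_point (p : cell_point) : Prop :=
  (exists u v t, [/\ (u == v) || adj u v, 0 <= t <= 1 & p = segment_point u v t])
  \/
  (exists c rs, [/\ face c, (`[0, 1] `*` `[0, 1]) rs & p = face_map c rs]).

Definition polygonal_complex : Type := {p : cell_point | is_cell_point p}.

HB.instance Definition _ := gen_eqMixin polygonal_complex.
HB.instance Definition _ := gen_choiceMixin polygonal_complex.

(* The CW topology: final for the characteristic maps of the edges and of the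
   2-cells. Polar coordinates present the closed disc as a quotient of the
   compact square, so openness may be tested on the square. *)
Definition complex_open (A : set polygonal_complex) : Prop :=
  (forall u v : X, adj u v ->
     open (segment_point u v @^-1` (sval @` A) : set (subspace `[0, 1]))) /\
  (forall c : loop, face c ->
     open (face_map c @^-1` (sval @` A) :
       set (subspace (`[0, 1] `*` `[0, 1])))).

Lemma complex_openT : complex_open setT.
Proof.
split=> [u v uv|c cf]; rewrite -open_subspaceIT.
  rewrite (_ : _ `&` _ = `[0, 1]%classic); first exact: open_subspaceT.
  apply/seteqP; split=> [t []//|t t01]; split=> //=.
  have tP : is_cell_point (segment_point u v t).
    by left; exists u, v, t; split=> //; rewrite uv orbT.
  by exists (exist _ _ tP).
rewrite (_ : _ `&` _ = `[0, 1]%classic `*` `[0, 1]); first exact: open_subspaceT.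
apply/seteqP; split=> [t []//|t t01]; split=> //.
have tP : is_cell_point (face_map c t) by right; exists c, t.
by exists (exist _ _ tP).
Qed.

Lemma image_svalI (A B : set polygonal_complex) :
  sval @` (A `&` B) = (sval @` A) `&` (sval @` B).
Proof.
apply/seteqP; split=> [_ [p [Ap Bp] <-]|_ [[p Ap <-] [q Bq qp]]].
  by split; exists p.
exists p => //; split=> //; congr B: Bq.
by case: p q {Ap} qp => p pP [q qP] /= qp; exact: eq_exist.
Qed.

Lemma complex_openI : setI_closed complex_open.
Proof.
move=> A B [A1 A2] [B1 B2]; split=> [u v uv|c cf]; rewrite image_svalI.
  by rewrite preimage_setI; apply: openI; [exact: A1|exact: B1].
by rewrite preimage_setI; apply: openI; [exact: A2|exact: B2].
Qed.

Lemma complex_open_bigU (I : Type) (F : I -> set polygonal_complex) :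
  (forall i, complex_open (F i)) -> complex_open (\bigcup_i F i).
Proof.
move=> FO; split=> [u v uv|c cf]; rewrite image_bigcup preimage_bigcup.
  by apply: bigcup_open => i _; have [+ _] := FO i; exact.
by apply: bigcup_open => i _; have [_ +] := FO i; exact.
Qed.

HB.instance Definition _ := isOpenTopological.Build polygonal_complex
  complex_openT complex_openI complex_open_bigU.

Definition k_simply_connected : Prop := simply_connected R polygonal_complex.

End PolygonalComplex.

(* Main.v *)
From HB Require Import structures.
Require Import Defs.
From mathcomp Require Import all_boot all_order all_algebra.
From mathcomp Require Import all_classical all_reals.
From mathcomp Require Import interval_inference topology normedtype trigo.
From mathcomp Require Import ring lra zify.

(* Let F_y be the set of the x such that f(x) is K-close to y. By (i) and (iii), a
   point of F_y can be moved to a point of F_y' along any path from y to y', by a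
   bounded distance per step, and by (iii) two points of F_y at distance at most R
   are in fact C'-close: up to this relation the F_y are the fibres of a covering
   of Y. A loop in Y bounds a disc in P_k(Y); a fine grid on the disc, each of
   whose points is labelled by a vertex whose open star contains its image, turns
   the null-homotopy into an array of vertices of Y in which neighbours are
   boundedly close. Lifting this array row by row to X shows that the covering has
   no monodromy, which gives the lower bound of the quasi-isometry, and that every
   closed walk in X is a product of closed walks of length at most l, conjugated by
   walks.

   In P_l(X) closed walks of length at most l are null-homotopic, because they
   decompose into simple loops. Hence all closed walks have trivial class in the
   fundamental group, so that the classes of the edges are the coboundary of a
   potential on the vertices. The open faces and the open stars without the face
   centres cover P_l(X) by sets contractible in P_l(X); the potential extends to the
   whole complex through their contractions, and shows that every loop is null. *)

Set Implicit Arguments.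
Unset Strict Implicit.
Unset Printing Implicit Defensive.

Import Order.TTheory GRing.Theory Num.Theory.
Import numFieldNormedType.Exports.

Local Open Scope classical_set_scope.
Local Open Scope ring_scope.

(** * Homotopy of paths *)

(** Injectivity on the fibres holds only at scale R, so lifts must not drift as the array grows. Two
    lifts of the same vertex that are known to be R-close are automatically C'-close, and this
    resets the error after each row; the threshold [5 * D * C'], with [D = 2k + C + 1], is the cost
    of one reset, whatever the length of the loop. The distance estimate and the triviality of
    closed walks come from one lifting argument, run with a function [gam] on pairs of vertices that
    takes values in an arbitrary group and is multiplicative at scale [(D + 1) * C']. In the second
    half, chosen tails to a base point give every path, closed or not, a class in one group; if this
    class is locally a coboundary, it is one along every path, by connectedness of the line. The
    obstacle is the topology: X need not be locally finite, the complex carries the final topology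
    of its cells, and contractions of stars must be continuous jointly in point and time.
    Compactness of time intervals reduces this to openness of tubes, which is tested cell by
    cell. *)

Section ContinuityCombinators.
Variables (R : realType) (S : topologicalType).
Implicit Types f g : S -> R.

Lemma continuous_const (T : topologicalType) (a : T) : continuous (fun _ : S => a).
Proof. by move=> x; exact: cvg_cst. Qed.

Lemma continuous_ident : continuous (fun x : S => x).
Proof. by move=> x; exact: cvg_id. Qed.

Lemma continuous_addr f g : continuous f -> continuous g -> continuous (fun x => f x + g x).
Proof. by move=> cf cg x; exact: cvgD (cf x) (cg x). Qed.

Lemma continuous_oppr f : continuous f -> continuous (fun x => - f x).
Proof. by move=> cf x; exact: cvgN (cf x). Qed.

Lemma continuous_mulr f g : continuous f -> continuous g -> continuous (fun x => f x * g x).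
Proof. by move=> cf cg x; exact: cvgM (cf x) (cg x). Qed.

Lemma continuous_maxr f g : continuous f -> continuous g ->
  continuous (fun x => Num.max (f x) (g x)).
Proof. by move=> cf cg x; exact: continuous_max (cf x) (cg x). Qed.

Lemma continuous_minr f g : continuous f -> continuous g ->
  continuous (fun x => Num.min (f x) (g x)).
Proof. by move=> cf cg x; exact: continuous_min (cf x) (cg x). Qed.

Lemma continuous_normr f : continuous f -> continuous (fun x => `|f x|).
Proof. by move=> cf x; exact: cvg_norm (cf x). Qed.

Lemma continuous_pairing (T U : topologicalType) (f : S -> T) (g : S -> U) :
  continuous f -> continuous g -> continuous (fun x => (f x, g x)).
Proof. by move=> cf cg x; exact: cvg_pair (cf x) (cg x). Qed.

Lemma continuous_fst_comp (T U : topologicalType) (f : S -> T * U) :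
  continuous f -> continuous (fun x => (f x).1).
Proof. by move=> cf x; apply: cvg_comp (cf x) _; exact: cvg_fst. Qed.

Lemma continuous_snd_comp (T U : topologicalType) (f : S -> T * U) :
  continuous f -> continuous (fun x => (f x).2).
Proof. by move=> cf x; apply: cvg_comp (cf x) _; exact: cvg_snd. Qed.

Lemma continuous_compose (T U : topologicalType) (h : T -> U) (f : S -> T) :
  continuous h -> continuous f -> continuous (fun x => h (f x)).
Proof. by move=> ch cf x; apply: cvg_comp (cf x) (ch _). Qed.

Lemma continuous_if_le (U : topologicalType) (b c : S -> R) (f g : S -> U) :
  continuous b -> continuous c -> continuous f -> continuous g ->
  (forall x, b x = c x -> f x = g x) ->
  continuous (fun x => if b x <= c x then f x else g x).
Proof.
move=> cb cc cf cg fg.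
pose d x := c x - b x.
have cd : continuous d by apply: continuous_addr => //; exact: continuous_oppr.
have cA : closed [set x | 0 <= d x].
  exact: (closed_comp (fun x _ => cd x) (@closed_ge R 0)).
have cB : closed [set x | d x <= 0].
  exact: (closed_comp (fun x _ => cd x) (@closed_le R 0)).
pose h x := if b x <= c x then f x else g x; rewrite -/h.
have AB : [set x | 0 <= d x] `|` [set x | d x <= 0] = setT.
  by apply/seteqP; split=> // x _; have [?|/ltW ?] := leP 0 (d x); [left|right].
have : {within setT, continuous h}.
  rewrite -AB; apply: withinU_continuous => //.
    apply: (subspace_eq_continuous (f := f)); last exact: continuous_subspaceT.
    by move=> x; rewrite inE /= /d subr_ge0 => bc; rewrite /from_subspace /h bc.
  apply: (subspace_eq_continuous (f := g)); last exact: continuous_subspaceT.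
  move=> x; rewrite inE /= /d subr_le0 => cbx; rewrite /from_subspace /h.
  by case: ifP => // bc; symmetry; apply: fg; apply/le_anti/andP.
move=> ch x; have /(_ x) := ch.
by rewrite /continuous_at /= nbhs_subspaceT.
Qed.
End ContinuityCombinators.

Section Clamp.
Variable R : realType.
(** The retraction of the line onto [0, 1]. Composing with it turns continuity within [0, 1] into
    continuity on the line, so that paths and homotopies can be total continuous functions. *)
Definition clamp (x : R) : R := Num.max 0 (Num.min 1 x).

Lemma clamp01 x : 0 <= clamp x <= 1.
Proof. by rewrite /clamp le_max lexx /= ge_max ge_min lexx ler01. Qed.

Lemma clampE x : 0 <= x <= 1 -> clamp x = x.
Proof. by move=> /andP[x0 x1]; rewrite /clamp min_r ?max_r. Qed.

Lemma clamp_continuous : continuous clamp.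
Proof.
apply: continuous_maxr; first exact: continuous_const.
by apply: continuous_minr; [exact: continuous_const|exact: continuous_ident].
Qed.

Lemma continuous_clamp_comp (S : topologicalType) (f : S -> R) :
  continuous f -> continuous (fun x => clamp (f x)).
Proof. exact: continuous_compose clamp_continuous. Qed.

Lemma clampK x : clamp (clamp x) = clamp x.
Proof. exact/clampE/clamp01. Qed.

Lemma clamp0 : clamp 0 = 0. Proof. by rewrite clampE// lexx ler01. Qed.
Lemma clamp1 : clamp 1 = 1. Proof. by rewrite clampE// lexx ler01. Qed.

Lemma within_continuous_clamp (T U : topologicalType) (A : set T) (f : T -> U)
    (S : topologicalType) (c : S -> T) :
  {within A, continuous f} -> continuous c -> (forall x, A (c x)) ->
  continuous (fun x => f (c x)).
Proof.
move=> /subspace_continuousP cf cc cA x.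
apply: (@cvg_comp _ _ _ c f _ (within A (nbhs (c x)))); last exact: cf.
move=> B AB; have : nbhs x (c @^-1` [set y | A y -> B y]) := cc x _ AB.
by apply: filterS => y /(_ (cA y)).
Qed.
End Clamp.

(* Dispatching on the head symbol keeps unification from unfolding real
   operations in search of a match. *)
Ltac continuity := cbv beta; first [assumption | lazymatch goal with
  | |- forall x, _ x (fun y => y) => exact: continuous_ident
  | |- forall x, _ x (fun y => @Algebra.add _ (@?f y) (@?g y)) =>
      apply: (continuous_addr (f := f) (g := g)); continuity
  | |- forall x, _ x (fun y => @Algebra.opp _ (@?f y)) =>
      apply: (continuous_oppr (f := f)); continuity
  | |- forall x, _ x (fun y => @GRing.mul _ (@?f y) (@?g y)) =>
      apply: (continuous_mulr (f := f) (g := g)); continuity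
  | |- forall x, _ x (fun y => Order.max (@?f y) (@?g y)) =>
      apply: (continuous_maxr (f := f) (g := g)); continuity
  | |- forall x, _ x (fun y => Order.min (@?f y) (@?g y)) =>
      apply: (continuous_minr (f := f) (g := g)); continuity
  | |- forall x, _ x (fun y => Num.norm (@?f y)) =>
      apply: (continuous_normr (f := f)); continuity
  | |- forall x, _ x (fun y => (@?f y, @?g y)) =>
      apply: (continuous_pairing (f := f) (g := g)); continuity
  | |- forall x, _ x (fun y => (@?f y).1) =>
      apply: (continuous_fst_comp (f := f)); continuity
  | |- forall x, _ x (fun y => (@?f y).2) =>
      apply: (continuous_snd_comp (f := f)); continuity
  | |- forall x, _ x fst => by move=> ?; exact: cvg_fst
  | |- forall x, _ x snd => by move=> ?; exact: cvg_snd
  | |- forall x, _ x (fun y => clamp (@?f y)) =>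
      apply: (continuous_clamp_comp (f := f)); continuity
  | |- forall x, _ x (@GRing.mul _ ?c) =>
      apply: (continuous_mulr (f := fun=> c) (g := id));
      [exact: continuous_const|exact: continuous_ident]
  | |- forall x, _ x (@Algebra.add _ ?c) =>
      apply: (continuous_addr (f := fun=> c) (g := id));
      [exact: continuous_const|exact: continuous_ident]
  | |- _ => try exact: continuous_const
  end].

Section Homotopy.
Variables (R : realType) (T : topologicalType).
Implicit Types a b c : R -> T.

(* Paths are functions on the whole line of which only the restriction to
   [0, 1] matters. *)
Definition path_homotopic a b := exists H : R * R -> T,
  [/\ continuous H, forall s, H (s, 0) = a (clamp s),
      forall s, H (s, 1) = b (clamp s) &
      forall t, H (0, t) = a 0 /\ H (1, t) = a 1].

Definition path_cat a b (s : R) : T :=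
  if s <= 2^-1 then a (clamp (2 * s)) else b (clamp (2 * s - 1)).

Definition path_rev a (s : R) : T := a (1 - s).

Lemma path_cat0 a b : path_cat a b 0 = a 0.
Proof. by rewrite /path_cat invr_ge0 ler0n mulr0 clamp0. Qed.

Lemma path_cat1 a b : path_cat a b 1 = b 1.
Proof.
rewrite /path_cat ifF ?mulr1; last by apply/negbTE; lra.
by rewrite (_ : 2 - 1 = 1) ?clamp1//; lra.
Qed.

Lemma path_cat_continuous a b : continuous a -> continuous b -> a 1 = b 0 ->
  continuous (path_cat a b).
Proof.
move=> ca cb ab; apply: continuous_if_le; continuity.
- by apply: (continuous_compose ca); continuity.
- by apply: (continuous_compose cb); continuity.
- move=> x ->; rewrite divff ?pnatr_eq0// subrr clamp0 clamp1//.
Qed.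

Lemma path_rev_continuous a : continuous a -> continuous (path_rev a).
Proof. by move=> ca; apply: (continuous_compose ca); continuity. Qed.

Lemma path_homotopic_ends a b : path_homotopic a b -> a 0 = b 0 /\ a 1 = b 1.
Proof.
move=> [H [_ _ H1 He]]; have [] := He 1.
by rewrite !H1 clamp0 clamp1 => -> ->.
Qed.

Lemma path_homotopic_refl a : continuous a -> path_homotopic a a.
Proof.
move=> ca; exists (fun x => a (clamp x.1)); split=> //=; last first.
  by rewrite clamp0 clamp1.
by apply: (continuous_compose ca); continuity.
Qed.

Lemma path_homotopic_sym a b : path_homotopic a b -> path_homotopic b a.
Proof.
move=> ab; have [a0 a1] := path_homotopic_ends ab.
move: ab => [H [cH H0 H1 He]]; exists (fun x => H (x.1, 1 - x.2)); split=> /=.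
- by apply: (continuous_compose cH); continuity.
- by move=> s; rewrite subr0.
- by move=> s; rewrite subrr.
- by move=> t; rewrite -a0 -a1; exact: He.
Qed.

Lemma path_homotopic_trans b a c :
  path_homotopic a b -> path_homotopic b c -> path_homotopic a c.
Proof.
move=> ab; have [a0 a1] := path_homotopic_ends ab.
move: ab => [H [cH H0 H1 He]] [H' [cH' H'0 H'1 H'e]].
exists (fun x => if x.2 <= 2^-1 then H (x.1, 2 * x.2) else H' (x.1, 2 * x.2 - 1)).
split=> [|s|s|t] /=.
- apply: continuous_if_le; continuity.
  + by apply: (continuous_compose cH); continuity.
  + by apply: (continuous_compose cH'); continuity.
  + by move=> x ->; rewrite divff ?pnatr_eq0// subrr H1 H'0.
- by rewrite invr_ge0 ler0n mulr0 H0.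
- rewrite ifF ?mulr1; last by apply/negbTE; lra.
  by rewrite (_ : 2 - 1 = 1) ?H'1//; lra.
- by case: ifP => _; [exact: He|rewrite a0 a1; exact: H'e].
Qed.

Lemma path_homotopic_ext a a' b b' :
  (forall s, 0 <= s <= 1 -> a s = a' s) -> (forall s, 0 <= s <= 1 -> b s = b' s) ->
  path_homotopic a b -> path_homotopic a' b'.
Proof.
move=> aa bb [H [cH H0 H1 He]]; exists H; split=> // [s|s|t].
- by rewrite H0 aa// clamp01.
- by rewrite H1 bb// clamp01.
- by rewrite -!aa ?lexx ?ler01//; exact: He.
Qed.

Lemma path_homotopic_cat a a' b b' : a 1 = b 0 ->
  path_homotopic a a' -> path_homotopic b b' ->
  path_homotopic (path_cat a b) (path_cat a' b').
Proof.
move=> ab [H [cH H0 H1 He]] [H' [cH' H'0 H'1 H'e]].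
exists (fun x => if clamp x.1 <= 2^-1 then H (2 * clamp x.1, x.2)
                 else H' (2 * clamp x.1 - 1, x.2)).
have cx : continuous (fun x : R * R => clamp x.1).
  by continuity.
split=> [|s|s|t] /=.
- apply: continuous_if_le; continuity.
  + by apply: (continuous_compose cH); continuity.
  + by apply: (continuous_compose cH'); continuity.
  + move=> x ->; rewrite divff ?pnatr_eq0// subrr.
    by have [_ ->] := He x.2; have [->] := H'e x.2.
- by rewrite /path_cat H0 H'0.
- by rewrite /path_cat H1 H'1.
- rewrite clamp0 clamp1 path_cat0 path_cat1 invr_ge0 ler0n mulr0; split.
    by have [] := He t.
  rewrite ifF ?mulr1; last by apply/negbTE; lra.
  by rewrite (_ : 2 - 1 = 1) ?H'1; [have [] := H'e t|lra].
Qed.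

(* Linear interpolation between the two reparametrisations. *)
Lemma path_homotopic_comp (F : R * R -> T) (p q : R -> R * R) :
  continuous F -> continuous p -> continuous q -> p 0 = q 0 -> p 1 = q 1 ->
  path_homotopic (fun s => F (p s)) (fun s => F (q s)).
Proof.
move=> cF cp cq p0 p1.
have cs : continuous (fun x : R * R => clamp x.1).
  by continuity.
have cps : continuous (fun x : R * R => p (clamp x.1)) by apply: continuous_compose.
have cqs : continuous (fun x : R * R => q (clamp x.1)) by apply: continuous_compose.
exists (fun x => F ((1 - x.2) * (p (clamp x.1)).1 + x.2 * (q (clamp x.1)).1,
                    (1 - x.2) * (p (clamp x.1)).2 + x.2 * (q (clamp x.1)).2)).
split=> [|s|s|t] /=.
- by apply: (continuous_compose cF); continuity.
- by congr F; rewrite subr0 !mul1r !mul0r !addr0; case: (p _).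
- by congr F; rewrite subrr !mul1r !mul0r !add0r; case: (q _).
- rewrite clamp0 clamp1 -p0 -p1.
  by split; congr F; rewrite -!mulrDl !subrK !mul1r; case: (p _).
Qed.

Lemma path_homotopic_reparam a (p q : R -> R) :
  continuous a -> continuous p -> continuous q -> p 0 = q 0 -> p 1 = q 1 ->
  path_homotopic (fun s => a (p s)) (fun s => a (q s)).
Proof.
move=> ca cp cq p0 p1.
apply: (@path_homotopic_comp (fun x => a x.1) (fun s => (p s, 0)) (fun s => (q s, 0))).
- by apply: (continuous_compose ca); continuity.
- by continuity.
- by continuity.
- by rewrite p0.
- by rewrite p1.
Qed.

Lemma path_catA a b c : continuous a -> continuous b -> continuous c ->
  a 1 = b 0 -> b 1 = c 0 ->
  path_homotopic (path_cat a (path_cat b c)) (path_cat (path_cat a b) c).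
Proof.
move=> ca cb cc ab bc.
pose h := path_cat (path_cat a b) c.
(* The slopes 1/2, 1, 2 increase, so the piecewise linear change of parameter between the two
   bracketings is the maximum of its affine pieces, which makes continuity immediate. *)
pose p (s : R) := Num.max (Num.max (s / 2) (s - 4^-1)) (2 * s - 1).
have ch : continuous h.
  by apply: path_cat_continuous; rewrite ?path_cat1//; apply: path_cat_continuous.
have : path_homotopic (fun s => h (p s)) (fun s => h s).
  apply: (path_homotopic_reparam (p := p) (q := id) ch); rewrite /p; continuity.
    by rewrite mul0r mulr0 !sub0r !max_l//; lra.
  by rewrite max_r ?ge_max; lra.
apply: path_homotopic_ext => // s /andP[s0 s1].
have [s12|s12] := leP s 2^-1.
  have -> : p s = s / 2 by rewrite /p !max_l//; lra.
  rewrite /h /path_cat s12 ifT; last by lra.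
  rewrite (clampE (x := 2 * (s / 2))); last by lra.
  rewrite ifT; last by lra.
  by congr (a (clamp _)); lra.
have [s34|s34] := leP s (3 / 4).
  have -> : p s = s - 4^-1 by rewrite /p max_l ?max_r//; lra.
  rewrite /h /path_cat ifT; last by lra.
  rewrite (clampE (x := 2 * (s - _))); last by lra.
  rewrite ifF; last by apply/negbTE; lra.
  rewrite [RHS]ifF; last by apply/negbTE; lra.
  rewrite (clampE (x := 2 * s - 1)); last by lra.
  rewrite ifT; last by lra.
  by congr (b (clamp _)); lra.
have -> : p s = 2 * s - 1 by rewrite /p max_r ?ge_max//; lra.
rewrite /h /path_cat ifF; last by apply/negbTE; lra.
rewrite [RHS]ifF; last by apply/negbTE; lra.
rewrite (clampE (x := 2 * s - 1)); last by lra.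
by rewrite ifF//; apply/negbTE; lra.
Qed.

Lemma path_cat_constl a : continuous a ->
  path_homotopic (path_cat (fun=> a 0) a) a.
Proof.
move=> ca; pose p (s : R) := Num.max 0 (2 * s - 1).
have : path_homotopic (fun s => a (p s)) (fun s => a s).
  apply: (path_homotopic_reparam (p := p) (q := id) ca); rewrite /p; continuity.
    by rewrite mulr0 max_l//; lra.
  by rewrite max_r; lra.
apply: path_homotopic_ext => // s /andP[s0 s1]; rewrite /p /path_cat.
have [s12|s12] := leP s 2^-1; first by rewrite max_l//; lra.
by rewrite max_r ?clampE//; lra.
Qed.

Lemma path_cat_constr a : continuous a ->
  path_homotopic (path_cat a (fun=> a 1)) a.
Proof.
move=> ca; pose p (s : R) := Num.min 1 (2 * s).
have : path_homotopic (fun s => a (p s)) (fun s => a s).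
  apply: (path_homotopic_reparam (p := p) (q := id) ca); rewrite /p; continuity.
    by rewrite mulr0 min_r//; lra.
  by rewrite min_l//; lra.
apply: path_homotopic_ext => // s /andP[s0 s1]; rewrite /p /path_cat.
have [s12|s12] := leP s 2^-1; first by rewrite min_r ?clampE//; lra.
by rewrite min_l//; lra.
Qed.

Lemma path_cat_revl a : continuous a ->
  path_homotopic (path_cat (path_rev a) a) (fun=> a 1).
Proof.
move=> ca; pose p (s : R) := `|2 * s - 1|.
have : path_homotopic (fun s => a (p s)) (fun s => a 1).
  apply: (path_homotopic_reparam (p := p) (q := fun=> 1) ca); rewrite /p; continuity.
    by rewrite mulr0 sub0r normrN normr1.
  by rewrite (_ : 2 * 1 - 1 = 1) ?normr1//; lra.
apply: path_homotopic_ext => // s /andP[s0 s1]; rewrite /p /path_cat /path_rev.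
have [s12|s12] := leP s 2^-1.
  by rewrite clampE ?ler0_norm; [congr a| |]; lra.
by rewrite clampE ?ger0_norm; [congr a| |]; lra.
Qed.

Lemma path_revK a : path_rev (path_rev a) = a.
Proof. by apply/funext => s; rewrite /path_rev; congr a; lra. Qed.

Lemma path_cat_revr a : continuous a ->
  path_homotopic (path_cat a (path_rev a)) (fun=> a 0).
Proof.
move=> ca; have := path_cat_revl (path_rev_continuous ca).
by rewrite path_revK /path_rev subrr.
Qed.

Lemma path_homotopic_rev a b :
  path_homotopic a b -> path_homotopic (path_rev a) (path_rev b).
Proof.
move=> [H [cH H0 H1 He]]; exists (fun x => H (1 - clamp x.1, x.2)); split=> /=.
- apply: (continuous_compose cH); continuity.
- move=> s; rewrite H0 clampE //; have := clamp01 s; lra.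
- move=> s; rewrite H1 clampE //; have := clamp01 s; lra.
- move=> t; rewrite clamp0 clamp1 /path_rev subr0 subrr.
  by have [-> ->] := He t.
Qed.

End Homotopy.

(** * The fundamental group *)

Section FundamentalGroup.
Variables (R : realType) (T : topologicalType) (x0 : T).
Implicit Types a b c : R -> T.

Definition loop_at a := [/\ continuous a, a 0 = x0 & a 1 = x0].

Definition pi1 : Type :=
  {A : set (R -> T) | exists2 a, loop_at a & A = path_homotopic a}.

HB.instance Definition _ := gen_eqMixin pi1.
HB.instance Definition _ := gen_choiceMixin pi1.

Lemma loop_at_cst : loop_at (fun=> x0).
Proof. by split=> //; exact: continuous_const. Qed.

Lemma loop_at_cat a b : loop_at a -> loop_at b -> loop_at (path_cat a b).
Proof.
move=> [ca a0 a1] [cb b0 b1]; split; rewrite ?path_cat0 ?path_cat1//.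
by apply: path_cat_continuous => //; rewrite a1.
Qed.

Lemma loop_at_rev a : loop_at a -> loop_at (path_rev a).
Proof.
move=> [ca a0 a1]; split; [exact: path_rev_continuous| |].
  by rewrite /path_rev subr0.
by rewrite /path_rev subrr.
Qed.

Definition pi1_class a : pi1 :=
  if pselect (loop_at a) is left la
  then exist _ (path_homotopic a) (ex_intro2 _ _ a la erefl)
  else exist _ (path_homotopic (fun=> x0))
         (ex_intro2 _ _ (fun=> x0) loop_at_cst erefl).

Definition pi1_rep (g : pi1) : R -> T := projT1 (cid2 (proj2_sig g)).

Lemma pi1_rep_loop g : loop_at (pi1_rep g).
Proof. by rewrite /pi1_rep; case: cid2. Qed.

Lemma pi1_classP a b : loop_at a -> loop_at b ->
  pi1_class a = pi1_class b <-> path_homotopic a b.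
Proof.
move=> la lb; rewrite /pi1_class; case: pselect => // la'; case: pselect => // lb'.
split=> [/(congr1 sval)/= ->|ab]; first by apply: path_homotopic_refl; case: lb.
apply: eq_exist; apply/funext => c; apply/propext; split=> h.
  by apply: path_homotopic_trans h; exact: path_homotopic_sym.
exact: path_homotopic_trans h.
Qed.

Lemma pi1_repK g : pi1_class (pi1_rep g) = g.
Proof.
have lg := pi1_rep_loop g.
rewrite /pi1_class; case: pselect => // lg'; case: g lg lg' => A eA lg lg'.
apply: eq_exist; rewrite /pi1_rep; case: cid2 => /= a la.
by move: eA lg lg' => _ _ _ ->.
Qed.

Definition pi1_mul g h := pi1_class (path_cat (pi1_rep g) (pi1_rep h)).
Definition pi1_inv g := pi1_class (path_rev (pi1_rep g)).
Definition pi1_one := pi1_class (fun=> x0).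

Lemma pi1_class_rep a : loop_at a -> path_homotopic (pi1_rep (pi1_class a)) a.
Proof. by move=> la; apply/pi1_classP; rewrite ?pi1_repK//; exact: pi1_rep_loop. Qed.

Lemma pi1_class_cat a b : loop_at a -> loop_at b ->
  pi1_mul (pi1_class a) (pi1_class b) = pi1_class (path_cat a b).
Proof.
move=> la lb; apply/pi1_classP; do ?apply: loop_at_cat => //; try exact: pi1_rep_loop.
have [_ _ r1] := pi1_rep_loop (pi1_class a).
have [_ r0 _] := pi1_rep_loop (pi1_class b).
by apply: path_homotopic_cat; [rewrite r1|exact: pi1_class_rep|exact: pi1_class_rep].
Qed.

Lemma pi1_class_rev a : loop_at a -> pi1_inv (pi1_class a) = pi1_class (path_rev a).
Proof.
move=> la; apply/pi1_classP; do ?apply: loop_at_rev => //; try exact: pi1_rep_loop.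
exact/path_homotopic_rev/pi1_class_rep.
Qed.

Lemma pi1_mulA : associative pi1_mul.
Proof.
move=> f g h; rewrite -(pi1_repK f) -(pi1_repK g) -(pi1_repK h).
have lf := pi1_rep_loop f; have lg := pi1_rep_loop g; have lh := pi1_rep_loop h.
rewrite !pi1_class_cat//; do ?apply: loop_at_cat => //.
apply/pi1_classP; do ?apply: loop_at_cat => //.
move: lf lg lh => [cf f0 f1] [cg g0 g1] [ch h0 h1].
by apply: path_catA => //; rewrite ?f1 ?g1.
Qed.

Lemma pi1_mul1g : left_id pi1_one pi1_mul.
Proof.
move=> g; rewrite -(pi1_repK g); have lg := pi1_rep_loop g.
rewrite pi1_class_cat//; last exact: loop_at_cst.
apply/pi1_classP => //; first by apply: loop_at_cat => //; exact: loop_at_cst.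
by move: lg => [cg g0 g1]; rewrite -[X in path_cat (fun=> X)]g0; exact: path_cat_constl.
Qed.

Lemma pi1_mulg1 : right_id pi1_one pi1_mul.
Proof.
move=> g; rewrite -(pi1_repK g); have lg := pi1_rep_loop g.
rewrite pi1_class_cat//; last exact: loop_at_cst.
apply/pi1_classP => //; first by apply: loop_at_cat => //; exact: loop_at_cst.
move: lg => [cg g0 g1]; rewrite -[X in path_cat _ (fun=> X)]g1; exact: path_cat_constr.
Qed.

Lemma pi1_mulVg : left_inverse pi1_one pi1_inv pi1_mul.
Proof.
move=> g; rewrite -(pi1_repK g); have lg := pi1_rep_loop g.
rewrite pi1_class_rev// pi1_class_cat//; last exact: loop_at_rev.
apply/pi1_classP; [|exact: loop_at_cst|].
  by apply: loop_at_cat => //; exact: loop_at_rev.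
by move: lg => [cg g0 g1]; rewrite -[X in _ (fun=> X)]g1; exact: path_cat_revl.
Qed.

Lemma pi1_mulgV : right_inverse pi1_one pi1_inv pi1_mul.
Proof.
move=> g; rewrite -(pi1_repK g); have lg := pi1_rep_loop g.
rewrite pi1_class_rev// pi1_class_cat//; last exact: loop_at_rev.
apply/pi1_classP; [|exact: loop_at_cst|].
  by apply: loop_at_cat => //; exact: loop_at_rev.
by move: lg => [cg g0 g1]; rewrite -[X in _ (fun=> X)]g0; exact: path_cat_revr.
Qed.

HB.instance Definition _ := isGroup.Build pi1
  pi1_mulA pi1_mul1g pi1_mulg1 pi1_mulVg pi1_mulgV.

End FundamentalGroup.

(** * Classes of arbitrary paths in one group *)

Definition path_connected (R : realType) (T : topologicalType) :=
  forall x y : T, exists a : R -> T, [/\ continuous a, a 0 = x & a 1 = y].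

Section PathClass.
Variables (R : realType) (T : topologicalType) (x0 : T).
Hypothesis pcT : path_connected R T.
Implicit Types a b c : R -> T.

Let beta (x : T) : R -> T := projT1 (cid (pcT x0 x)).

Let betaP x : [/\ continuous (beta x), beta x 0 = x0 & beta x 1 = x].
Proof. by rewrite /beta; case: cid. Qed.

(* Every path is turned into a loop with the help of chosen paths from the
   base point; this makes its class an element of a single group. *)
Definition path_class a : pi1 R x0 :=
  pi1_class x0 (path_cat (beta (a 0)) (path_cat a (path_rev (beta (a 1))))).

Let lasso a : continuous a ->
  loop_at x0 (path_cat (beta (a 0)) (path_cat a (path_rev (beta (a 1))))).
Proof.
move=> ca; have [cb0 b00 b01] := betaP (a 0); have [cb1 b10 b11] := betaP (a 1).
have cr := path_rev_continuous cb1.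
split; rewrite ?path_cat0 ?path_cat1//; last by rewrite /path_rev subrr.
apply: path_cat_continuous; rewrite ?path_cat0//; apply: path_cat_continuous => //.
by rewrite /path_rev subr0.
Qed.

Lemma path_class_homotopic a b : continuous a -> continuous b ->
  path_homotopic a b -> path_class a = path_class b.
Proof.
move=> ca cb ab; apply/pi1_classP; [exact: lasso|exact: lasso|].
have [a0 a1] := path_homotopic_ends ab; rewrite -a0 -a1.
have [cb0 b00 b01] := betaP (a 0); have [cb1 b10 b11] := betaP (a 1).
have cr := path_rev_continuous cb1.
apply: path_homotopic_cat; rewrite ?path_cat0//; first exact: path_homotopic_refl.
apply: path_homotopic_cat => //; first by rewrite /path_rev subr0.
exact: path_homotopic_refl.
Qed.

Lemma path_class_ext a b : continuous a -> continuous b ->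
  (forall s, 0 <= s <= 1 -> a s = b s) -> path_class a = path_class b.
Proof.
move=> ca cb ab; apply: path_class_homotopic => //.
by apply: (path_homotopic_ext (a := a) (b := a)) => //; exact: path_homotopic_refl.
Qed.

(** The tail that closes the first lasso at [a 1] cancels against the tail that opens the second at
    [b 0]; the rest is reassociation. In the proof [p], [q], [r] are the tails to [a 0], [b 0],
    [b 1]. *)
Lemma path_class_cat a b : continuous a -> continuous b -> a 1 = b 0 ->
  path_class (path_cat a b) = (path_class a * path_class b)%g.
Proof.
move=> ca cb ab; rewrite /path_class.
rewrite -[RHS]/(pi1_mul _ _) pi1_class_cat; try exact: lasso.
apply/pi1_classP; first by apply: lasso; exact: path_cat_continuous.
  by apply: loop_at_cat; exact: lasso.
rewrite path_cat0 path_cat1.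
have [cp p0 p1] := betaP (a 0); have [cq q0 q1] := betaP (b 0).
have [cr r0 r1] := betaP (b 1); rewrite ab.
move: (beta (a 0)) (beta (b 0)) (beta (b 1)) cp p0 p1 cq q0 q1 cr r0 r1 => p q r.
move=> cp p0 p1 cq q0 q1 cr r0 r1.
have crr := path_rev_continuous cr; have cqr := path_rev_continuous cq.
have rr0 : path_rev r 0 = r 1 by rewrite /path_rev subr0.
have qr0 : path_rev q 0 = q 1 by rewrite /path_rev subr0.
have qr1 : path_rev q 1 = q 0 by rewrite /path_rev subrr.
have cbr : continuous (path_cat b (path_rev r)).
  by apply: path_cat_continuous; rewrite ?rr0.
have caq : continuous (path_cat a (path_rev q)).
  by apply: path_cat_continuous; rewrite ?qr0 ?q1.
have cqbr : continuous (path_cat q (path_cat b (path_rev r))).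
  by apply: path_cat_continuous; rewrite ?path_cat0 ?q1.
have cqq : continuous (path_cat (path_rev q) q) by apply: path_cat_continuous.
apply: path_homotopic_sym.
apply: (path_homotopic_trans (b := path_cat p (path_cat (path_cat a (path_rev q))
    (path_cat q (path_cat b (path_rev r)))))).
  by apply: path_homotopic_sym; apply: path_catA; rewrite ?path_cat0 ?path_cat1 ?p1.
apply: path_homotopic_cat; rewrite ?path_cat0//; first exact: path_homotopic_refl.
apply: (path_homotopic_trans (b := path_cat a (path_cat (path_rev q)
    (path_cat q (path_cat b (path_rev r)))))).
  apply: path_homotopic_sym; apply: path_catA; rewrite ?path_cat0 ?qr0 ?q1//.
apply: (path_homotopic_trans (b := path_cat a (path_cat b (path_rev r)))); last first.
  by apply: path_catA; rewrite ?rr0 ?r1.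
apply: path_homotopic_cat; rewrite ?path_cat0 ?qr0 ?q1//.
  exact: path_homotopic_refl.
apply: (path_homotopic_trans (b := path_cat (path_cat (path_rev q) q)
    (path_cat b (path_rev r)))).
  by apply: path_catA; rewrite ?path_cat0 ?q1.
apply: (path_homotopic_trans (b := path_cat (fun=> q 1) (path_cat b (path_rev r)))).
  apply: path_homotopic_cat; rewrite ?path_cat0 ?path_cat1 ?q1//.
    by rewrite -q1; exact: path_cat_revl.
  exact: path_homotopic_refl.
have := path_cat_constl cbr; by rewrite path_cat0 q1.
Qed.

Definition segment_path (F : R * R -> T) (A B : R * R) (s : R) : T :=
  F ((1 - s) * A.1 + s * B.1, (1 - s) * A.2 + s * B.2).

Lemma segment_path_continuous F A B : continuous F -> continuous (segment_path F A B).
Proof. by move=> cF; apply: (continuous_compose cF); continuity. Qed.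

Lemma segment_path0 F A B : segment_path F A B 0 = F A.
Proof. by rewrite /segment_path subr0 !mul1r !mul0r !addr0; case: A. Qed.

Lemma segment_path1 F A B : segment_path F A B 1 = F B.
Proof. by rewrite /segment_path subrr !mul1r !mul0r !add0r; case: B. Qed.

(** In the plane the broken line A, B, C and the segment AC are homotopic by linear interpolation,
    and [F] carries this homotopy to [T]. *)
Lemma path_class_triangle F A B C : continuous F ->
  (path_class (segment_path F A B) * path_class (segment_path F B C))%g =
  path_class (segment_path F A C).
Proof.
move=> cF; have cs A' B' : continuous (segment_path F A' B').
  exact: segment_path_continuous.
rewrite -path_class_cat//; last by rewrite segment_path0 segment_path1.
have cat : continuous (path_cat (segment_path F A B) (segment_path F B C)).
  by apply: path_cat_continuous; rewrite // segment_path0 segment_path1.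
apply: path_class_homotopic => //.
pose p (s : R) := if s <= 2^-1 then
   ((1 - clamp (2 * s)) * A.1 + clamp (2 * s) * B.1,
    (1 - clamp (2 * s)) * A.2 + clamp (2 * s) * B.2) else
   ((1 - clamp (2 * s - 1)) * B.1 + clamp (2 * s - 1) * C.1,
    (1 - clamp (2 * s - 1)) * B.2 + clamp (2 * s - 1) * C.2).
pose q (s : R) := ((1 - s) * A.1 + s * C.1, (1 - s) * A.2 + s * C.2).
have cp : continuous p.
  apply: continuous_if_le; continuity => x ->.
  by rewrite divff ?pnatr_eq0// subrr clamp0 clamp1 subrr subr0 !mul0r !mul1r !add0r !addr0.
have cq : continuous q by rewrite /q; continuity.
have := @path_homotopic_comp _ _ F p q cF cp cq; rewrite /p /q.
have -> : 0 <= 2^-1 :> R by rewrite invr_ge0 ler0n.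
have -> : 1 <= 2^-1 :> R = false by apply/negbTE; lra.
have -> : 2 * 1 - 1 = 1 :> R by lra.
rewrite mulr0 clamp0 clamp1 subr0 subrr !mul0r !add0r !addr0 => /(_ erefl erefl).
apply: path_homotopic_ext => // s s01; rewrite /path_cat /segment_path.
by case: ifP.
Qed.

Lemma path_class_segment_refl F A : continuous F ->
  path_class (segment_path F A A) = 1%g.
Proof.
move=> cF; apply: (mulgI (path_class (segment_path F A A))).
by rewrite mulg1 path_class_triangle.
Qed.

Lemma path_class_segmentV F A B : continuous F ->
  path_class (segment_path F B A) = (path_class (segment_path F A B))^-1%g.
Proof.
move=> cF; apply: (mulgI (path_class (segment_path F A B))).
by rewrite path_class_triangle// mulgV path_class_segment_refl.
Qed.

Lemma path_class_cst x : path_class (fun=> x) = 1%g.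
Proof.
by rewrite -(path_class_segment_refl (F := fun=> x) (0, 0))//; exact: continuous_const.
Qed.

(** Triviality of the class says that the lasso [p a p^-1] is null. Cancelling [p] on the left gives
    [e1], that [a p^-1] is homotopic to [p^-1]; multiplying by [p] on the right then contracts [a]
    itself. *)
Lemma path_class_null a : continuous a -> a 0 = a 1 -> path_class a = 1%g ->
  path_homotopic a (fun=> a 0).
Proof.
move=> ca a01 /(pi1_classP (lasso ca) (loop_at_cst R x0)); rewrite -a01 => h.
have [cp p0 p1] := betaP (a 0).
move: (beta (a 0)) cp p0 p1 h => p cp p0 p1 h.
have cr := path_rev_continuous cp.
have r0 : path_rev p 0 = p 1 by rewrite /path_rev subr0.
have r1 : path_rev p 1 = p 0 by rewrite /path_rev subrr.
have car : continuous (path_cat a (path_rev p)).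
  by apply: path_cat_continuous; rewrite // r0 p1 a01.
have e1 : path_homotopic (path_cat a (path_rev p)) (path_rev p).
  apply: (path_homotopic_trans (b := path_cat (path_rev p)
      (path_cat p (path_cat a (path_rev p))))); last first.
    apply: (path_homotopic_trans (b := path_cat (path_rev p) (fun=> x0))); last first.
      by have := path_cat_constr cr; rewrite r1 p0.
    apply: path_homotopic_cat; rewrite ?path_cat0 ?r1//.
    exact: path_homotopic_refl.
  apply: path_homotopic_sym.
  apply: (path_homotopic_trans (b := path_cat (path_cat (path_rev p) p)
      (path_cat a (path_rev p)))).
    by apply: path_catA; rewrite ?path_cat0.
  apply: (path_homotopic_trans (b := path_cat (fun=> p 1) (path_cat a (path_rev p)))).
    apply: path_homotopic_cat; rewrite ?path_cat0 ?path_cat1 ?p1//.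
      by rewrite -p1; exact: path_cat_revl.
    exact: path_homotopic_refl.
  by have := path_cat_constl car; rewrite path_cat0 p1.
apply: (path_homotopic_trans (b := path_cat a (path_cat (path_rev p) p))).
  apply: path_homotopic_sym.
  apply: (path_homotopic_trans (b := path_cat a (fun=> a 1))); last exact: path_cat_constr.
  apply: path_homotopic_cat; rewrite ?path_cat0 ?r0 ?p1//.
    exact: path_homotopic_refl.
  by rewrite -a01 -p1; exact: path_cat_revl.
apply: (path_homotopic_trans (b := path_cat (path_cat a (path_rev p)) p)).
  by apply: path_catA; rewrite ?r0 ?p1.
apply: (path_homotopic_trans (b := path_cat (path_rev p) p)).
  apply: path_homotopic_cat => //; first by rewrite path_cat1 r1.
  exact: path_homotopic_refl.
by rewrite -p1; exact: path_cat_revl.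
Qed.
End PathClass.

(** * Cells of the polygonal complex *)

Section Cells.
Variables (R : realType) (k : nat) (X : sgraph).
Local Notation P := (polygonal_complex R k X).
Implicit Types (u v w : X) (c : loop X) (s t : R) (q : R * R).

(** Degenerate edges are allowed so that a walk can stand still and be padded to any length; the
    first alternative of [is_cell_point] uses the same relation. *)
Definition lazy_adj u v := (u == v) || adj u v.

Lemma segment_point0 u v : segment_point u v 0 = GraphPoint (fun w => (w == u)%:R : R).
Proof.
by congr GraphPoint; apply/funext => w; rewrite subr0 mul1r mul0r addr0.
Qed.

Lemma segment_point1 u v : segment_point u v 1 = GraphPoint (fun w => (w == v)%:R : R).
Proof.
by congr GraphPoint; apply/funext => w; rewrite subrr mul1r mul0r add0r.
Qed.

Lemma segment_point_refl u t : segment_point u u t = GraphPoint (fun w => (w == u)%:R : R).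
Proof.
by congr GraphPoint; apply/funext => w; rewrite -mulrDl subrK mul1r.
Qed.

Lemma is_cell_segment u v t : lazy_adj u v -> 0 <= t <= 1 ->
  is_cell_point k (segment_point u v t).
Proof. by move=> uv t01; left; exists u, v, t. Qed.

Lemma is_cell_vertex u : is_cell_point k (segment_point u u (0 : R)).
Proof. by apply: is_cell_segment; rewrite /lazy_adj ?eqxx ?lexx ?ler01. Qed.

Definition to_complex u (p : cell_point R X) : P :=
  if pselect (is_cell_point k p) is left h then exist _ p h
  else exist _ _ (is_cell_vertex u).

Lemma to_complexK u p : is_cell_point k p -> sval (to_complex u p) = p.
Proof. by rewrite /to_complex; case: pselect. Qed.

Lemma polygonal_complex_eq (p p' : P) : sval p = sval p' -> p = p'.
Proof. by case: p p' => p h [p' h'] /= e; exact: eq_exist. Qed.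

(** Characteristic maps of the cells, extended by [clamp] to the line and to the plane, where
    straight segments and linear interpolation need no side conditions. The vertex passed to
    [to_complex] only supplies a junk value. *)
Definition edge_path u v t : P := to_complex u (segment_point u v (clamp t)).

Definition face_path c q : P := to_complex c.1 (face_map c (clamp q.1, clamp q.2)).

Lemma val_edge_path u v t : lazy_adj u v ->
  sval (edge_path u v t) = segment_point u v (clamp t).
Proof. by move=> uv; rewrite to_complexK//; apply: is_cell_segment => //; exact: clamp01. Qed.

Lemma val_face_path c q : face k c ->
  sval (face_path c q) = face_map c (clamp q.1, clamp q.2).
Proof.
move=> fc; rewrite to_complexK//; right; exists c, (clamp q.1, clamp q.2).
by split=> //; split=> /=; rewrite in_itv/=; exact: clamp01.
Qed.

Lemma complex_pointP (p : P) :
  (exists u v t, [/\ lazy_adj u v, 0 <= t <= 1 & p = edge_path u v t]) \/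
  (exists c q, [/\ face k c, 0 <= q.1 <= 1, 0 <= q.2 <= 1 & p = face_path c q]).
Proof.
case: (svalP p) => [[u [v [t [uv t01 e]]]]|[c [q [fc [q1 q2] e]]]].
  left; exists u, v, t; split=> //; apply: polygonal_complex_eq.
  by rewrite val_edge_path// clampE.
right; exists c, q; move: q1 q2; rewrite /= !in_itv/= => q1 q2; split=> //.
apply: polygonal_complex_eq.
by rewrite val_face_path// !clampE//; case: q {q1 q2} e.
Qed.

Let clamp_edge_preimage u v (A : set P) : lazy_adj u v ->
  (segment_point u v @^-1` (sval @` A)) `&` `[0, 1] = edge_path u v @^-1` A `&` `[0, 1].
Proof.
move=> uv; apply/seteqP; split=> t []; rewrite /= in_itv/= => a t01; split=> //.
  case: a => p Ap e; suff <- : p = edge_path u v t by [].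
  by apply: polygonal_complex_eq; rewrite val_edge_path// clampE.
by exists (edge_path u v t) => //; rewrite val_edge_path// clampE.
Qed.

Let clamp_face_preimage c (A : set P) : face k c ->
  (face_map c @^-1` (sval @` A)) `&` (`[0, 1] `*` `[0, 1]) =
  face_path c @^-1` A `&` (`[0, 1] `*` `[0, 1]).
Proof.
move=> fc; apply/seteqP; split=> -[t s] []; rewrite /= !in_itv/= => a [t01 s01]; split=> //.
  case: a => p Ap e; suff <- : p = face_path c (t, s) by [].
  by apply: polygonal_complex_eq; rewrite val_face_path//= !clampE.
by exists (face_path c (t, s)) => //; rewrite val_face_path//= !clampE.
Qed.

Lemma complex_openP (A : set P) :
  (forall u v, adj u v -> open (edge_path u v @^-1` A)) ->
  (forall c, face k c -> open (face_path c @^-1` A)) -> open A.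
Proof.
move=> oe of_; suff : complex_open A by [].
split=> [u v uv|c fc].
  rewrite -open_subspaceIT clamp_edge_preimage; last by rewrite /lazy_adj uv orbT.
  by rewrite open_subspaceIT; apply: open_subspaceW; exact: oe.
by rewrite -open_subspaceIT clamp_face_preimage// open_subspaceIT;
  apply: open_subspaceW; exact: of_.
Qed.

Lemma edge_path_continuous u v : lazy_adj u v -> continuous (edge_path u v).
Proof.
case/orP => [/eqP ->|uv].
  rewrite (_ : edge_path v v = fun=> edge_path v v 0); first exact: continuous_const.
  apply/funext => t; apply: polygonal_complex_eq.
  by rewrite !val_edge_path ?/lazy_adj ?eqxx// !segment_point_refl.
have lz : lazy_adj u v by rewrite /lazy_adj uv orbT.
have -> : edge_path u v = (fun t => edge_path u v (clamp t)).
  by apply/funext => t; rewrite /edge_path clampK.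
apply: (within_continuous_clamp (A := `[0, 1]%classic : set R)
  (f := edge_path u v) (c := @clamp R)); last 2 first.
  exact: clamp_continuous.
  by move=> t; rewrite /= in_itv/=; exact: clamp01.
apply/continuousP => O [oO _]; have := oO u v uv.
by rewrite -open_subspaceIT clamp_edge_preimage// open_subspaceIT.
Qed.

Lemma face_path_continuous c : face k c -> continuous (face_path c).
Proof.
move=> fc.
have -> : face_path c = (fun q => face_path c (clamp q.1, clamp q.2)).
  by apply/funext => t; rewrite /face_path !clampK.
apply: (within_continuous_clamp (A := `[0, 1]%classic `*` `[0, 1]%classic : set (R * R))
  (f := face_path c) (c := fun q => (clamp q.1, clamp q.2))); last 2 first.
  by continuity.
  by move=> t; split; rewrite /= in_itv/=; exact: clamp01.
apply/continuousP => O [_ oO]; have := oO c fc.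
by rewrite -open_subspaceIT clamp_face_preimage// open_subspaceIT.
Qed.
End Cells.
Arguments to_complex {R k X}.
Arguments edge_path {R k X}.
Arguments face_path {R k X}.

(** * Graph distance and attaching maps *)

Lemma divn_succ M i : (0 < M)%N ->
  (i.+1 %/ M = i %/ M \/ i.+1 %/ M = (i %/ M).+1)%N.
Proof.
move=> M0; have := leq_div2r M (leqnSn i).
have : (i.+1 %/ M < (i %/ M).+2)%N.
  by rewrite ltn_divLR// mulSn; have := ltn_ceil i M0; lia.
by lia.
Qed.

Section GraphDistance.
Variable X : sgraph.
Implicit Types x y z : X.

Lemma walk_refl x : walk x x 0.
Proof. by exists [::]. Qed.

Lemma walk_adj x y : adj x y -> walk x y 1.
Proof. by move=> xy; exists [:: y]; rewrite /= xy. Qed.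

Lemma walk_cat x y z m n : walk x y m -> walk y z n -> walk x z (m + n).
Proof.
move=> [p [xp <- <-]] [q [yq <- <-]]; exists (p ++ q).
by rewrite cat_path xp yq last_cat size_cat.
Qed.

Lemma walk_sym x y n : walk x y n -> walk y x n.
Proof.
move=> [p [xp <- <-]]; exists (rev (belast x p)).
rewrite rev_path size_rev size_belast; split=> //.
  by rewrite (eq_path (e' := adj))// => u v; rewrite adj_sym.
by case: p xp => //= a p _; rewrite rev_cons last_rcons.
Qed.

Hypothesis cX : graph_connected X.

Lemma gdist_walk x y : walk x y (gdist x y).
Proof.
rewrite /gdist; case: xgetP => [n ->|h]; first by case.
have ex : exists n, `[< walk x y n >] by have [n w] := cX x y; exists n; apply/asboolP.
case: (h (ex_minn ex)); case: ex_minnP => n /asboolP w nmin; split=> // m wm.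
by apply: nmin; exact/asboolP.
Qed.

Lemma gdist_le x y n : walk x y n -> (gdist x y <= n)%N.
Proof.
move=> w; rewrite /gdist; case: xgetP => [m -> [_]|h]; first exact.
by rewrite leq0n.
Qed.

Lemma gdistxx x : gdist x x = 0%N.
Proof. by apply/eqP; rewrite -leqn0; exact: gdist_le (walk_refl x). Qed.

Lemma gdistC x y : gdist x y = gdist y x.
Proof.
by apply/eqP; rewrite eqn_leq !gdist_le//; apply: walk_sym; exact: gdist_walk.
Qed.

Lemma gdist_triangle y x z : (gdist x z <= gdist x y + gdist y z)%N.
Proof. by apply: gdist_le; apply: walk_cat; exact: gdist_walk. Qed.

Lemma gdist_lazy x y : lazy_adj x y -> (gdist x y <= 1)%N.
Proof.
by case/orP => [/eqP ->|xy]; [rewrite gdistxx|apply: gdist_le; exact: walk_adj].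
Qed.

Lemma walk_nth x y n : walk x y n -> exists z : nat -> X,
  [/\ z 0%N = x, forall j, (n <= j)%N -> z j = y & forall j, lazy_adj (z j) (z j.+1)].
Proof.
move=> [p [xp lp <-]]; exists (nth y (x :: p)); split=> // [j|j].
  rewrite leq_eqVlt => /predU1P[<-|pj]; last by rewrite nth_default.
  by rewrite -(last_nth y) lp.
have [jp|pj] := ltnP j (size p).
  by rewrite /lazy_adj; apply/orP; right; exact: (pathP y xp).
rewrite [X in lazy_adj _ X]nth_default//.
move: pj; rewrite leq_eqVlt => /predU1P[<-|pj]; last first.
  by rewrite nth_default// /lazy_adj eqxx.
by rewrite -(last_nth y) lp /lazy_adj eqxx.
Qed.

Lemma gdist_split x z n : (gdist x z <= n.+1)%N ->
  exists2 y, (gdist x y <= n)%N & (gdist y z <= 1)%N.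
Proof.
move=> d; have [w [w0 wn wl]] := walk_nth (gdist_walk x z).
have wd j : (gdist x (w j) <= j)%N.
  elim: j => [|j IH]; first by rewrite w0 gdistxx.
  rewrite -[X in (_ <= X)%N]addn1; apply: leq_trans (gdist_triangle (w j) _ _) _.
  by apply: leq_add => //; exact: gdist_lazy.
exists (w n); first exact: wd.
have <- := wn _ d; exact: gdist_lazy (wl n).
Qed.

Lemma gdist_seq (z : nat -> X) i j (C : nat) : (i <= j)%N ->
  (forall l, (i <= l < j)%N -> (gdist (z l) (z l.+1) <= C)%N) ->
  (gdist (z i) (z j) <= (j - i) * C)%N.
Proof.
elim: j => [|j IH]; first by case: i => //; rewrite gdistxx.
rewrite leq_eqVlt => /predU1P[->|]; first by rewrite gdistxx.
rewrite ltnS => ij h; rewrite subSn// mulSn addnC.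
apply: leq_trans (gdist_triangle (z j) _ _) _; apply: leq_add.
  by apply: IH => // l /andP[il lj]; apply: h; rewrite il ltnS ltnW.
by apply: h; rewrite ij /=.
Qed.

Lemma gdist_loop (x : X) p v w : path adj x p -> v \in x :: p -> w \in x :: p ->
  (gdist v w <= size p)%N.
Proof.
move=> xp; wlog ij : v w / (index v (x :: p) <= index w (x :: p))%N => [h vp wp|].
  have [/h|/ltnW/h] := leqP (index v (x :: p)) (index w (x :: p)); first exact.
  by rewrite gdistC; exact.
move=> vp wp; rewrite -(nth_index x vp) -(nth_index x wp).
apply: (@leq_trans ((index w (x :: p) - index v (x :: p)) * 1)).
  apply: gdist_seq => // l /andP[_ lw]; apply: gdist_lazy.
  rewrite /lazy_adj; apply/orP; right; apply: (pathP x xp).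
  by move: wp; rewrite -index_mem /= ltnS; exact: leq_trans.
rewrite muln1; apply: leq_trans (leq_subr _ _) _.
by rewrite -ltnS index_mem.
Qed.
End GraphDistance.

Section Attach.
Variables (R : realType) (X : sgraph).
Implicit Types (c : loop X) (s t a : R) (v : X).

(** The tent function. At position [a] along the boundary of a polygon, the vertex at index [i]
    contributes the barycentric coordinate [hat (a - i)]. *)
Definition hat (a : R) : R := Num.max 0 (1 - `|a|).

Lemma hat_ge0 a : 0 <= hat a.
Proof. by rewrite /hat le_max lexx. Qed.

Lemma attachE c i s t : 0 <= t < 1 -> (size c.2)%:R * s = i%:R + t ->
  attach c s = segment_point (nth c.1 (c.1 :: c.2) i) (nth c.1 (c.1 :: c.2) i.+1) t.
Proof.
move=> /andP[t0 t1] e; rewrite /attach e.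
have -> : Num.truncn (i%:R + t) = i.
  by apply/truncn_def; rewrite lerDl t0 -natr1 ltrD2l.
by rewrite [i%:R + t]addrC addrK.
Qed.

Lemma attach_segment c i s t : (i < size c.2)%N -> 0 <= t <= 1 ->
  (size c.2)%:R * s = i%:R + t ->
  attach c s = segment_point (nth c.1 (c.1 :: c.2) i) (nth c.1 (c.1 :: c.2) i.+1) t.
Proof.
move=> im /andP[t0]; rewrite le_eqVlt => /predU1P[->|t1] e; last first.
  by apply: attachE; rewrite ?t0.
rewrite segment_point1 (@attachE c i.+1 s 0) ?segment_point0 ?lexx ?ltr01//.
by rewrite e addr0 natr1.
Qed.

(** When the truncated index is the last one, that is for [s = 1] or on a 0-gon, [nth] falls back on
    its default for the next vertex; the final clause records that this vertex then has weight 0. *)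
Lemma loop_param c s : 0 <= s <= 1 -> exists i t,
  [/\ (i <= size c.2)%N, 0 <= t < 1, (size c.2)%:R * s = i%:R + t &
      (i == size c.2) ==> (t == 0)].
Proof.
move=> /andP[s0 s1]; set a := _ * s.
have a0 : 0 <= a by rewrite mulr_ge0.
have am : a <= (size c.2)%:R by rewrite /a ler_piMr.
have /andP[ta at1] := truncn_itv a0.
exists (Num.truncn a), (a - (Num.truncn a)%:R); split.
- by rewrite -(ler_nat R); exact: le_trans am.
- by rewrite subr_ge0 ta ltrBlDl natr1.
- by rewrite addrC subrK.
- apply/implyP => /eqP e; move: ta; rewrite e => ta.
  by rewrite subr_eq0 eq_le am.
Qed.

(** Only the tents at [j] and [j.+1] are nonzero at [j + t], with values [1 - t] and [t]. The
    formula replaces truncation by a sum of continuous functions, from which openness of stars is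
    read off. *)
Lemma attach_hat c s : 0 <= s <= 1 -> attach c s = GraphPoint (fun v =>
  \sum_(i < (size c.2).+1) (v == nth c.1 (c.1 :: c.2) i)%:R *
    hat ((size c.2)%:R * s - i%:R)).
Proof.
move=> s01; have [j [t [jm t01 e jt]]] := loop_param c s01.
rewrite (attachE t01 e) e; congr GraphPoint; apply/funext => v.
set w := c.1 :: c.2; have /andP[t0 t1] := t01.
have h0 (i : nat) : i != j -> i != j.+1 -> hat (j%:R + t - i%:R) = 0.
  move=> ij ij1; rewrite /hat max_l// subr_le0.
  have [lij|lji] := ltnP i j.
    apply: le_trans (ler_norm _); have : i.+1%:R <= j%:R :> R by rewrite ler_nat.
    by rewrite -natr1; lra.
  rewrite distrC; apply: le_trans (ler_norm _).
  have : j.+2%:R <= i%:R :> R by rewrite ler_nat; lia.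
  by rewrite -!natr1; lra.
have hj : hat (j%:R + t - j%:R) = 1 - t.
  by rewrite [j%:R + t]addrC addrK /hat ger0_norm// max_r//; lra.
have hj1 : hat (j%:R + t - j.+1%:R) = t.
  rewrite -natr1 /hat ler0_norm; last by lra.
  by rewrite max_r; lra.
have jm' : (j < (size c.2).+1)%N by [].
rewrite (bigD1 (Ordinal jm'))//= hj mulrC; congr (_ + _).
have [j1m|mj1] := ltnP j.+1 (size c.2).+1.
  rewrite (bigD1 (Ordinal j1m)) /=; last by rewrite -val_eqE /= gtn_eqF.
  rewrite hj1 mulrC big1 ?addr0// => i /andP[].
  by rewrite -!val_eqE /= => ij ij1; rewrite h0 ?mulr0.
rewrite big1; last first.
  move=> i; rewrite -val_eqE /= => ij; rewrite h0 ?mulr0//.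
  by rewrite neq_ltn (leq_trans (ltn_ord i)).
by move: jt; rewrite (_ : j == _) => [/eqP->|]; rewrite ?mul0r// eqn_leq jm.
Qed.

Lemma attach0 c : attach c 0 = segment_point c.1 c.1 (0 : R).
Proof.
by rewrite (@attachE c 0%N 0 0) ?mulr0 ?addr0 ?lexx ?ltr01// !segment_point0.
Qed.

Lemma attach_vertex c i s : (size c.2)%:R * s = i%:R ->
  attach c s = segment_point (nth c.1 (c.1 :: c.2) i) (nth c.1 (c.1 :: c.2) i) (0 : R).
Proof.
by move=> e; rewrite (@attachE c i s 0) ?addr0 ?lexx ?ltr01// !segment_point0.
Qed.

Lemma attach1 c : last c.1 c.2 = c.1 -> attach c 1 = attach c (0 : R).
Proof.
move=> lc; rewrite (@attach_vertex c (size c.2)) ?mulr1// attach0.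
by rewrite -(last_nth c.1) lc.
Qed.
End Attach.

(** * Open stars *)

Section SumContinuity.
Variables (R : realType) (S : topologicalType).

Lemma continuous_sumr n (f : nat -> S -> R) : (forall i, continuous (f i)) ->
  continuous (fun x => \sum_(i < n) f i x).
Proof.
move=> cf; elim: n => [|n IH].
  rewrite (_ : (fun x => _) = fun=> 0); first exact: continuous_const.
  by apply/funext => x; rewrite big_ord0.
rewrite (_ : (fun x => _) = fun x => \sum_(i < n) f i x + f n x); first by continuity.
by apply/funext => x; rewrite big_ord_recr.
Qed.

Lemma open_pos (f : S -> R) : continuous f -> open [set x | 0 < f x].
Proof. move=> cf; exact: (open_comp (fun x _ => cf x) (@open_gt R 0)). Qed.
End SumContinuity.

Section Stars.
Variables (R : realType) (k : nat) (X : sgraph).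
Local Notation P := (polygonal_complex R k X).
Implicit Types (u v w : X) (c : loop X) (s t : R) (q : R * R).

(** An open face belongs as a whole to the star of each of its vertices. These stars label the
    points of a null-homotopy; contractions are built on the smaller [punctured_star]. *)
Definition on_star v (p : cell_point R X) : Prop :=
  match p with
  | GraphPoint phi => 0 < phi v
  | FacePoint c _ => v \in c.1 :: c.2
  end.

Definition star v : set P := [set p | on_star v (sval p)].

Definition attach_coord c v s : R :=
  \sum_(i < (size c.2).+1) (v == nth c.1 (c.1 :: c.2) i)%:R *
    hat ((size c.2)%:R * s - i%:R).

Lemma attach_coord_continuous c v : continuous (fun s => attach_coord c v s).
Proof.
apply: (@continuous_sumr R R (size c.2).+1 (fun i s => (v == nth c.1 (c.1 :: c.2) i)%:R *
    hat ((size c.2)%:R * s - i%:R))) => i; rewrite /hat; continuity.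
Qed.

Lemma attach_coord_ge0 c v s : 0 <= attach_coord c v s.
Proof. by apply: sumr_ge0 => i _; rewrite mulr_ge0// hat_ge0. Qed.

Lemma attach_coord_gt0 c v s : 0 < attach_coord c v s -> exists i : nat,
  [/\ (i <= size c.2)%N, nth c.1 (c.1 :: c.2) i = v &
      `|(size c.2)%:R * s - i%:R| < 1].
Proof.
move=> h; apply: contrapT => /forallNP no; move: h.
rewrite /attach_coord big1 ?ltxx// => i _.
have [e|] := eqVneq v _; last by rewrite mul0r.
rewrite mul1r /hat max_l// subr_le0 leNgt; apply/negP => lt1.
by apply: (no i); split=> //; rewrite -ltnS.
Qed.

Lemma attach_coord_mem c v s : 0 < attach_coord c v s -> v \in c.1 :: c.2.
Proof. by move=> /attach_coord_gt0[i [im <- _]]; rewrite mem_nth. Qed.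

Lemma on_star_face v c q : 0 <= q.2 <= 1 -> q.1 <= 1 ->
  on_star v (face_map c q) <->
  if q.1 < 1 then v \in c.1 :: c.2 else 0 < attach_coord c v q.2.
Proof. by move=> q2 q1; rewrite /face_map; case: ifP => // _; rewrite attach_hat. Qed.

Lemma open_star v : open (star v).
Proof.
apply: complex_openP => [u w uw|c fc].
  rewrite (_ : _ @^-1` _ =
    [set t | 0 < (1 - clamp t) * (v == u)%:R + clamp t * (v == w)%:R]).
    by apply: open_pos; continuity.
  by apply/funext => t; rewrite /star/= val_edge_path// /lazy_adj uw orbT.
(* The conditions in the interior of the face and on its rim merge into positivity of one continuous
   function: the first term vanishes on the rim, and the second is positive only if [v] is on the
   loop. *)
rewrite (_ : _ @^-1` _ =
    [set q | 0 < (v \in c.1 :: c.2)%:R * (1 - clamp q.1) + attach_coord c v (clamp q.2)]).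
  have ca : continuous (fun q : R * R => attach_coord c v (clamp q.2)).
    by apply: (continuous_compose (@attach_coord_continuous c v)); continuity.
  by apply: open_pos; continuity.
apply/seteqP; split=> q; rewrite /star/= val_face_path//.
  have /andP[c0 c1] := clamp01 q.1.
  rewrite on_star_face//=; last exact: clamp01.
  case: ifP => [lt1 ->|_ h]; first by rewrite mul1r ltr_pwDl ?subr_gt0 ?attach_coord_ge0.
  by rewrite ltr_wpDl// mulr_ge0// subr_ge0.
move=> h; have /andP[c0 c1] := clamp01 q.1.
rewrite on_star_face//=; last exact: clamp01.
case: ifP => [lt1|ge1].
  case: (boolP (v \in _)) h => // nv; rewrite mul0r add0r => /attach_coord_mem.
  by rewrite (negbTE nv).
by move: h; rewrite (_ : clamp q.1 = 1) ?subrr ?mulr0 ?add0r//; lra.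
Qed.

Lemma on_star_edge v u w t : lazy_adj u w -> on_star v (sval (edge_path u w t : P)) ->
  v = u \/ v = w.
Proof.
move=> uw; rewrite val_edge_path//=.
have [->|vu] := eqVneq v u; first by left.
have [->|vw] := eqVneq v w; first by right.
by rewrite !mulr0 addr0 ltxx.
Qed.

Lemma on_star_face_mem v c q : face k c -> on_star v (sval (face_path c q : P)) ->
  v \in c.1 :: c.2.
Proof.
move=> fc; rewrite val_face_path//; have /andP[_ c1] := clamp01 q.1.
rewrite on_star_face//=; last exact: clamp01.
by case: ifP => // _; exact: attach_coord_mem.
Qed.

Lemma star_cover (p : P) : exists v, star v p.
Proof.
have [[u [w [t [uw t01 ->]]]]|[c [q [fc q1 q2 ->]]]] := complex_pointP p.
  have /andP[t0 t1] := t01.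
  have [t12|t12] := leP t 2^-1.
    exists u; rewrite /star/= val_edge_path//= eqxx mulr1 clampE//.
    by rewrite ltr_pwDl ?mulr_ge0//; lra.
  exists w; rewrite /star/= val_edge_path//= eqxx mulr1 clampE//.
  by rewrite ltr_wpDl ?mulr_ge0//; lra.
have [lt1|ge1] := ltP q.1 1.
  by exists c.1; rewrite /star/= val_face_path// clampE// clampE// /face_map /= lt1/= mem_head.
have [i [t [im t01 e _]]] := loop_param c q2.
exists (nth c.1 (c.1 :: c.2) i); rewrite /star/= val_face_path// clampE// clampE//.
rewrite /face_map ifF ?ltNge ?ge1// (attachE t01 e) /= eqxx mulr1.
by move: t01 => /andP[? ?]; rewrite ltr_pwDl ?mulr_ge0// subr_gt0.
Qed.

(** Two such vertices are ends of a common edge or lie on a common loop of length at most [k]: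
    incidence in the complex becomes distance in the graph. *)
Lemma star_gdist (p : P) v w : graph_connected X -> (0 < k)%N ->
  star v p -> star w p -> (gdist v w <= k)%N.
Proof.
move=> cX k0; have [[u [x [t [ux t01 ->]]]]|[c [q [fc q1 q2 ->]]]] := complex_pointP p.
  move=> /(on_star_edge ux) hv /(on_star_edge ux) hw.
  apply: leq_trans k0; move: hv hw => [->|->] [->|->]; rewrite ?gdistxx//.
    exact: gdist_lazy.
  by rewrite gdistC//; exact: gdist_lazy.
move=> /(on_star_face_mem fc) hv /(on_star_face_mem fc) hw.
case: fc => -[pc _ _] ck _; apply: leq_trans ck.
exact: (gdist_loop cX pc).
Qed.

Lemma star_vertex v u : star v (edge_path u u 0) -> v = u.
Proof. by case/(on_star_edge _); rewrite ?/lazy_adj ?eqxx. Qed.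

Lemma edge_path0 u v : lazy_adj u v -> edge_path u v 0 = edge_path u u 0 :> P.
Proof.
move=> uv; apply: polygonal_complex_eq; rewrite !val_edge_path ?/lazy_adj ?eqxx//.
by rewrite clamp0 !segment_point0.
Qed.

Lemma edge_path1 u v : lazy_adj u v -> edge_path u v 1 = edge_path v v 0 :> P.
Proof.
move=> uv; apply: polygonal_complex_eq; rewrite !val_edge_path ?/lazy_adj ?eqxx//.
by rewrite clamp0 clamp1 segment_point0 segment_point1.
Qed.

Lemma lazy_walk_path (z : nat -> X) n : (forall i, lazy_adj (z i) (z i.+1)) ->
  exists g : R -> P, continuous g /\
    forall i a, (i < n.+1)%N -> i%:R <= a <= i.+1%:R ->
      g a = edge_path (z i) (z i.+1) (a - i%:R).
Proof.
move=> zl; elim: n => [|n [g [cg gE]]].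
  exists (edge_path (z 0%N) (z 1%N)); split; first exact: edge_path_continuous.
  by case=> // a _ _; rewrite subr0.
exists (fun a => if a <= n.+1%:R then g a else edge_path (z n.+1) (z n.+2) (a - n.+1%:R)).
split.
  apply: continuous_if_le; continuity.
    by apply: (continuous_compose (edge_path_continuous (zl n.+1))); continuity.
  move=> a ->; rewrite (gE n)// ?ler_nat ?leqnn ?leqnSn ?lexx//.
  by rewrite -natr1 addrAC subrr add0r natr1 subrr edge_path0// edge_path1.
move=> i a; rewrite ltnS leq_eqVlt => /predU1P[->|im] /andP[ia ai]; last first.
  rewrite ifT; first by apply: gE => //; rewrite ia.
  by apply: le_trans ai _; rewrite ler_nat.
rewrite le_eqVlt in ia; case/predU1P : ia => [<-|ia]; last by rewrite leNgt ia.
rewrite lexx (gE n)// ?ler_nat ?leqnn ?leqnSn ?lexx//.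
by rewrite -natr1 addrAC subrr add0r natr1 subrr edge_path0// edge_path1.
Qed.
End Stars.

(** * Lebesgue numbers for maps of the square *)

Section Lebesgue.
Variables (R : realType) (T : topologicalType) (I : Type).

Lemma square_lebesgue_number (H : R * R -> T) (U : I -> set T) :
  continuous H -> (forall i, open (U i)) -> (forall p, exists i, U i p) ->
  exists n0, forall n, (n0 <= n)%N -> forall q : R * R,
    0 <= q.1 <= 1 -> 0 <= q.2 <= 1 -> exists i, forall q' : R * R,
    `|q.1 - q'.1| <= n.+1%:R^-1 -> `|q.2 - q'.2| <= n.+1%:R^-1 -> U i (H q').
Proof.
move=> cH oU cover.
pose Q : set (R * R) := `[0, 1] `*` `[0, 1].
have cQ : compact Q by apply: compact_setX; exact: segment_compact.
pose Pn n (q : R * R) := exists i, forall q' : R * R,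
  `|q.1 - q'.1| <= n.+1%:R^-1 -> `|q.2 - q'.2| <= n.+1%:R^-1 -> U i (H q').
have [n0 _ hn] : \forall n \near \oo, Q `<=` Pn n.
  move/compact_near_coveringP : cQ; apply => q _.
  have [i Ui] := cover (H q).
  have : nbhs q (H @^-1` U i) by apply: cH; exact: open_nbhs_nbhs.
  move=> /nbhs_ballP[e /= e0 be].
  have e2 : 0 < e / 2 by rewrite divr_gt0.
  near=> q' n => /=; exists i => q'' h1 h2; apply: be.
  have ne : n.+1%:R^-1 < e / 2 by near: n; exact: (near_infty_natSinv_lt (PosNum e2)).
  have [b1 b2] : ball q (e / 2) q' by near: q'; apply: nbhsx_ballx; rewrite divr_gt0.
  split; rewrite /ball /= in b1 b2 *.
    apply: le_lt_trans (ler_distD q'.1 _ _) _.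
    by rewrite [ltRHS](splitr e); apply: ltrD => //; exact: le_lt_trans h1 _.
  apply: le_lt_trans (ler_distD q'.2 _ _) _.
  by rewrite [ltRHS](splitr e); apply: ltrD => //; exact: le_lt_trans h2 _.
exists n0 => n nn q q1 q2; apply: (hn n nn q).
by split; rewrite /= in_itv/=; [exact: q1|exact: q2].
Unshelve. all: by end_near. Qed.
End Lebesgue.

(** * Coarse fillings of loops in the target *)

Section CoarseFilling.
Variables (R : realType) (k : nat) (Y : sgraph) (C : nat).
Hypotheses (cY : graph_connected Y) (k0 : (0 < k)%N) (C0 : (0 < C)%N).
Hypothesis scY : k_simply_connected R k Y.

(* [z] follows geodesics between the consecutive [y i] with exactly [C] steps
   each, standing still at the end when the geodesic is shorter. *)
Lemma lazy_refinement (y : nat -> Y) : (forall i, gdist (y i) (y i.+1) <= C)%N ->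
  exists z : nat -> Y, [/\ forall a, lazy_adj (z a) (z a.+1),
    forall i, z (i * C)%N = y i &
    forall a, (gdist (y (a %/ C)%N) (z a) <= C)%N].
Proof.
move=> yC.
have /choice[w wP] : forall i, exists w : nat -> Y,
    [/\ w 0%N = y i, forall j, (gdist (y i) (y i.+1) <= j)%N -> w j = y i.+1 &
        forall j, lazy_adj (w j) (w j.+1)].
  by move=> i; apply: walk_nth; exact: gdist_walk.
exists (fun a => w (a %/ C)%N (a %% C)%N); split=> [a|i|a].
- have [w0 wC wl] := wP (a %/ C)%N.
  have [e|ne] := eqVneq (a %% C).+1 C.
    have -> : a.+1 = ((a %/ C).+1 * C)%N.
      by rewrite {1}(divn_eq a C) -addnS e mulSnr.
    rewrite mulnK// modnMl; have [-> _ _] := wP (a %/ C)%N.+1.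
    by rewrite -(wC (a %% C).+1%N)// e.
  have lt : ((a %% C).+1 < C)%N by rewrite ltn_neqAle ne ltn_mod.
  have -> : a.+1 = (a %/ C * C + (a %% C).+1)%N by rewrite addnS -divn_eq.
  by rewrite divnMDl// modnMDl (divn_small lt) (modn_small lt) addn0; exact: wl.
- by rewrite mulnK// modnMl; have [] := wP i.
- have [<- _ wl] := wP (a %/ C)%N.
  apply: (@leq_trans ((a %% C - 0) * 1)).
    by apply: gdist_seq => // l _; apply: gdist_lazy => //; exact: wl.
  by rewrite subn0 muln1 ltnW// ltn_mod.
Qed.

(** The sequence is refined to a walk [z], drawn in the complex and contracted by [H]. At a vertex
    point the label of a grid point is forced, so the two sides and the top of the array are exactly
    [y 0]. *)
Let filling_aux (y : nat -> Y) (T : nat) : (0 < T)%N -> y T = y 0%N ->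
  (forall i, gdist (y i) (y i.+1) <= C)%N ->
  exists M m (v : nat -> nat -> Y), (0 < M)%N /\
    [/\ forall i, (i <= T * M)%N -> v i 0%N = y (i %/ M)%N /\ v i m = y 0%N,
        forall j, v 0%N j = y 0%N /\ v (T * M)%N j = y 0%N,
        forall i j, (i < T * M)%N -> (j <= m)%N ->
          (gdist (v i j) (v i.+1 j) <= (2 * k + C).+1)%N &
        forall i j, (i <= T * M)%N -> (j < m)%N ->
          (gdist (v i j) (v i j.+1) <= (2 * k + C).+1)%N].
Proof.
move=> T0 yT yC; have [z [zl zC zd]] := lazy_refinement yC.
pose N := (T * C)%N; have N0 : (0 < N)%N by rewrite muln_gt0 T0.
have [g [cg gE]] := lazy_walk_path R k N.-1 zl.
have {}gE i a : (i < N)%N -> i%:R <= a <= i.+1%:R ->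
  g a = edge_path (z i) (z i.+1) (a - i%:R) by move=> iN; apply: gE; rewrite prednK.
pose G s := g (N%:R * s).
have z0 : z 0%N = y 0%N by rewrite -(zC 0%N) mul0n.
have zN : z N = y 0%N by rewrite /N zC.
have G0 : G 0 = edge_path (y 0%N) (y 0%N) 0.
  by rewrite /G mulr0 (gE 0%N)// ?lexx ?ler01// subr0 edge_path0// z0.
have G1 : G 1 = edge_path (y 0%N) (y 0%N) 0.
  have [N' eN] : exists N', N = N'.+1 by exists N.-1; rewrite prednK.
  rewrite /G mulr1 (gE N') ?eN ?lexx ?ler_nat ?leqnSn//.
  by rewrite -natr1 addrAC subrr add0r edge_path1// -eN zN.
have cG : {within `[0, 1]%classic, continuous G}.
  apply: continuous_subspaceT.
  by apply: (continuous_compose (f := fun s : R => N%:R * s) cg); continuity.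
have [_ /(_ G cG)[|H0 [cH0 H00 H01 H0t]]] := scY; first by rewrite G0 G1.
pose H (q : R * R) := H0 (clamp q.1, clamp q.2).
have cH : continuous H.
  apply: (within_continuous_clamp (A := `[0, 1]%classic `*` `[0, 1]%classic : set (R * R))
    (f := H0) (c := fun q => (clamp q.1, clamp q.2))) => //; first by continuity.
  by move=> q; split; rewrite /= in_itv/=; exact: clamp01.
have [n0 leb] := square_lebesgue_number cH (@open_star R k Y) (@star_cover R k Y).
have /choice[lab labP] := @star_cover R k Y.
(* Each of the [N] edges of [z] gets [n0.+1] columns, so that edges start at grid points and the
   mesh respects the Lebesgue number; each step of [y] then takes [M] columns. *)
pose S := (N * n0.+1)%N; have S0 : (0 < S)%N by rewrite muln_gt0 N0.
have S0R : 0 < S%:R :> R by rewrite ltr0n.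
pose q (i j : nat) : R * R := (i%:R / S%:R, j%:R / S%:R).
have qS (i : nat) : (i <= S)%N -> 0 <= (i%:R / S%:R : R) <= 1.
  by move=> iS; rewrite divr_ge0 ?ler0n// ler_pdivrMr// mul1r ler_nat.
pose M := (C * n0.+1)%N; have M0 : (0 < M)%N by rewrite muln_gt0 C0.
have TM : (T * M)%N = S by rewrite /S /N mulnA.
(* The images of neighbouring grid points lie in the star of a common vertex [w], which is within
   [k] of both labels. *)
have Hlab i j i' j' : (i <= S)%N -> (j <= S)%N -> (i' <= i.+1)%N -> (i <= i')%N ->
    (j' <= j.+1)%N -> (j <= j')%N ->
    (gdist (lab (H (q i j))) (lab (H (q i' j'))) <= 2 * k)%N.
  move=> iS jS ii i'i jj j'j.
  have [|/=|/=|w wP] := leb S.-1 _ (q i j); rewrite ?qS//.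
    rewrite -ltnS prednK// /S; apply: leq_trans (leq_pmull _ N0); exact: ltnSn.
  have near_ (a b : nat) : (a <= b)%N -> (b <= a.+1)%N ->
      `|a%:R / S%:R - b%:R / S%:R| <= S%:R^-1 :> R.
    move=> ab ba; rewrite distrC -mulrBl -natrB// normrM normfV !normr_nat.
    by rewrite ler_piMl ?invr_ge0 ?ler0n// (ler_nat _ _ 1) leq_subLR addn1.
  have h1 : star w (H (q i j)) by apply: wP; rewrite /= subrr normr0 invr_ge0 ler0n.
  have h2 : star w (H (q i' j')) by apply: wP; rewrite prednK//; exact: near_.
  apply: leq_trans (gdist_triangle cY w _ _) _; rewrite mul2n -addnn.
  apply: leq_add; first exact: (star_gdist cY k0 (labP _) h1).
  exact: (star_gdist cY k0 h2 (labP _)).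
have lab_vertex u : lab (edge_path u u 0) = u by apply: star_vertex (labP _).
(* [z] stays within [C] of [y], and the label of a point on an edge of [z] is one of the ends of
   that edge, at most one step further. *)
have lab_bottom i : (i <= S)%N ->
    (gdist (y (i %/ M)%N) (lab (H (q i 0%N))) <= C.+1)%N.
  move=> iS; rewrite /H /q /= mul0r clamp0 clampE ?qS// H00 ?qS//.
  have [->|iSn] := eqVneq i S.
    by rewrite divff ?gt_eqF// G1 lab_vertex -TM mulnK// yT gdistxx.
  have {iSn}iS : (i < S)%N by rewrite ltn_neqAle iSn.
  have e : N%:R * (i%:R / S%:R) = i%:R / n0.+1%:R :> R.
    have nN : N%:R != 0 :> R by rewrite pnatr_eq0 -lt0n.
    have nn : n0.+1%:R != 0 :> R by rewrite pnatr_eq0.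
    rewrite /S natrM; move: (N%:R : R) (n0.+1%:R : R) nN nn => b d nb nd.
    by field; rewrite nb nd.
  pose a := (i %/ n0.+1)%N.
  have aN : (a < N)%N by rewrite ltn_divLR.
  have ai : a%:R <= (i%:R / n0.+1%:R : R) <= a.+1%:R.
    rewrite ler_pdivlMr ?ltr0n// ler_pdivrMr ?ltr0n// -!natrM !ler_nat.
    by rewrite leq_trunc_div /= ltnW// ltn_ceil.
  have := labP (G (i%:R / S%:R)); rewrite /G e (gE a)//.
  have -> : (i %/ M = a %/ C)%N by rewrite /M /a mulnC divnMA.
  case/(on_star_edge (zl a)) => ->; first by rewrite (leq_trans (zd a)).
  rewrite -[X in (_ <= X)%N]addn1; apply: leq_trans (gdist_triangle cY (z a) _ _) _.
  by apply: leq_add; [exact: zd|apply: gdist_lazy => //; exact: zl].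
(* Row 0 is [y] itself and the labels are shifted up by one row, so that the array starts exactly at
   the given sequence; hence its last row has index [S.+1]. *)
pose v i j := if j is j'.+1 then lab (H (q i j')) else y (i %/ M)%N.
exists M, S.+1, v; split=> //; rewrite TM; split=> [i iS|j|i j iS jS|i j iS jS].
- split=> //=; rewrite /H /q /= divff ?gt_eqF// clamp1 H01 ?G0 ?lab_vertex//.
  exact: clamp01.
- case: j => [|j] /=; first by rewrite div0n -TM mulnK.
  rewrite /H /q /= mul0r divff ?gt_eqF// clamp0 clamp1.
  have [-> ->] := H0t (clamp (j%:R / S%:R)) (clamp01 _).
  by rewrite G0 lab_vertex.
- case: j jS => [|j] jS /=.
    have [->|->] := divn_succ i M0.
    + by rewrite gdistxx.
    + by apply: leq_trans (yC _) _; lia.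
  by apply: leq_trans (Hlab i j i.+1 j _ _ _ _ _ _) _ => //; lia.
- case: j jS => [|j] jS /=; first by apply: leq_trans (lab_bottom i iS) _; lia.
  by apply: leq_trans (Hlab i j i j.+1 _ _ _ _ _ _) _ => //; lia.
Qed.

Lemma coarse_filling (y : nat -> Y) (T : nat) : (0 < T)%N -> y T = y 0%N ->
  (forall i, (i < T)%N -> gdist (y i) (y i.+1) <= C)%N ->
  exists M m (v : nat -> nat -> Y), (0 < M)%N /\
    [/\ forall i, (i <= T * M)%N -> v i 0%N = y (i %/ M)%N /\ v i m = y 0%N,
        forall j, v 0%N j = y 0%N /\ v (T * M)%N j = y 0%N,
        forall i j, (i < T * M)%N -> (j <= m)%N ->
          (gdist (v i j) (v i.+1 j) <= (2 * k + C).+1)%N &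
        forall i j, (i <= T * M)%N -> (j < m)%N ->
          (gdist (v i j) (v i j.+1) <= (2 * k + C).+1)%N].
Proof.
move=> T0 yT yC.
have [||M [m [v [M0 [h1 h2 h3 h4]]]]] := @filling_aux (fun i => y (minn i T)) T T0.
- by rewrite minnn min0n.
- move=> i /=; have [iT|Ti] := ltnP i T.
    by rewrite (minn_idPl iT); exact: yC.
  by rewrite (minn_idPr (leqW Ti)) gdistxx.
exists M, m, v; split=> //; split=> // [i iT|j].
  have [-> ->] := h1 i iT; rewrite /= min0n; split=> //.
  by congr y; apply/minn_idPl; rewrite -(mulnK T M0); exact: leq_div2r.
by have [-> ->] := h2 j; rewrite /= min0n.
Qed.
End CoarseFilling.

(** * Lifting through a coarse covering *)

Section Lifting.
Variables (X Y : sgraph) (f : X -> Y) (C C' K r R' D : nat).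
Hypotheses (cX : graph_connected X) (cY : graph_connected Y).
Hypotheses (C0 : (0 < C)%N) (C'0 : (0 < C')%N) (D0 : (0 < D)%N).
Hypotheses (R'K : (K + C <= R')%N) (rD : (5 * D * C' <= r)%N).
Hypothesis lift : forall x y, (gdist (f x) y <= R')%N ->
  exists x', (gdist x x' <= r)%N /\ (gdist (f x') y <= K)%N.
Hypothesis local_inj : forall x x', (gdist x x' <= r)%N ->
  (gdist (f x) (f x') <= C + 2 * K)%N -> (gdist x x' <= C')%N.

Definition lies_over (x : X) (y : Y) := (gdist (f x) y <= K)%N.

Lemma over_dist x x' y y' : lies_over x y -> lies_over x' y' ->
  (gdist (f x) (f x') <= 2 * K + gdist y y')%N.
Proof.
clear C0 C'0 D0 R'K rD lift local_inj.
rewrite /lies_over => h h'; have := gdist_triangle cY y (f x) (f x').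
by have := gdist_triangle cY y' y (f x'); rewrite (gdistC cY y' (f x')); lia.
Qed.

(** [lift] alone bounds the move by [r]. Since the images of [x] and [x'] are within [C + 2 * K],
    [local_inj] improves this to [C'], which does not grow with [r]. *)
Lemma over_step x y y' : lies_over x y -> (gdist y y' <= C)%N ->
  exists x', (gdist x x' <= C')%N /\ lies_over x' y'.
Proof.
clear C0 C'0 D0 rD.
move=> h d; have [|x' [d' h']] := @lift x y'.
  by apply: leq_trans (gdist_triangle cY y _ _) _; rewrite /lies_over in h; lia.
exists x'; split=> //; apply: local_inj => //.
by apply: leq_trans (over_dist h h') _; lia.
Qed.

Lemma over_transport n x y y' : lies_over x y -> (gdist y y' <= n)%N ->
  exists x', (gdist x x' <= n * C')%N /\ lies_over x' y'.
Proof.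
clear C'0 D0 rD.
elim: n y' => [|n IH] y' h d.
  exists x; rewrite gdistxx//; split=> //; move: h; rewrite /lies_over.
  by have := gdist_triangle cY y (f x) y'; lia.
have [y1 d1 d2] := gdist_split cY d; have [x1 [e1 h1]] := IH _ h d1.
have [x' [e' h']] := over_step h1 (leq_trans d2 C0); exists x'; split=> //.
by apply: leq_trans (gdist_triangle cX x1 _ _) _; rewrite mulSn; lia.
Qed.

Lemma over_unique x x' y : lies_over x y -> lies_over x' y -> (gdist x x' <= r)%N ->
  (gdist x x' <= C')%N.
Proof.
clear C0 C'0 D0 R'K rD lift.
move=> h h' d; apply: local_inj => //; apply: leq_trans (over_dist h h') _.
by rewrite gdistxx//; lia.
Qed.

Variables (G : groupType) (gam : X -> X -> G).
Hypothesis gam1 : forall x, gam x x = 1%g.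
Hypothesis gamM : forall x y z, (gdist x y <= D.+1 * C')%N ->
  (gdist y z <= D.+1 * C')%N -> (gam x y * gam y z = gam x z)%g.

(** The array is lifted column by column, starting from the given [x] over its bottom row. The
    lifted sides are constant and [gam] is multiplicative around the small squares, so the products
    along the bottom and the top agree; the top row stays near [x 0], where the product
    telescopes. *)
Lemma filling_monodromy (y : nat -> Y) (x : nat -> X) (T M m : nat)
    (v : nat -> nat -> Y) : (0 < T)%N -> (0 < M)%N -> y T = y 0%N ->
  (forall i, (i <= T)%N -> lies_over (x i) (y i)) ->
  (forall i, (i < T)%N -> (gdist (x i) (x i.+1) <= C')%N) ->
  (forall i, (i <= T * M)%N -> v i 0%N = y (i %/ M)%N /\ v i m = y 0%N) ->
  (forall j, v 0%N j = y 0%N /\ v (T * M)%N j = y 0%N) ->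
  (forall i j, (i < T * M)%N -> (j <= m)%N -> (gdist (v i j) (v i.+1 j) <= D)%N) ->
  (forall i j, (i <= T * M)%N -> (j < m)%N -> (gdist (v i j) (v i j.+1) <= D)%N) ->
  (gdist (x 0%N) (x T) <= C')%N /\
  (\prod_(i < T) gam (x i) (x i.+1))%g = gam (x 0%N) (x T).
Proof.
move=> T0 M0 yT ov xC vB vS vH vV.
pose h := (D.+1 * C')%N.
(* The origin of the constant 5: [3 * D + D.+1] is at most [5 * D] for positive [D]. The left side
   is the largest distance at which uniqueness of lifts is applied below. *)
have hr : (3 * D * C' + h <= r)%N by rewrite /h; nia.
(* Transport is chosen to leave [x] fixed when [v = w]; this keeps the lifts of the constant sides
   constant. *)
have [tr trP] : exists tr : X -> Y -> Y -> X, forall x v w,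
    (v = w -> tr x v w = x) /\ (lies_over x v -> (gdist v w <= D)%N ->
      (gdist x (tr x v w) <= D * C')%N /\ lies_over (tr x v w) w).
  have /choice[tr trP] : forall u : X * Y * Y, exists x', (u.1.2 = u.2 -> x' = u.1.1) /\
      (lies_over u.1.1 u.1.2 -> (gdist u.1.2 u.2 <= D)%N ->
      (gdist u.1.1 x' <= D * C')%N /\ lies_over x' u.2).
    move=> [[a b] c] /=; have [->|bc] := pselect (b = c).
      by exists a; rewrite !gdistxx; split=> // oa _; split.
    have [[oa d]|no] := pselect (lies_over a b /\ (gdist b c <= D)%N); last first.
      by exists a; split=> // oa d; exfalso; apply: no.
    by have [x' [? ?]] := over_transport oa d; exists x'.
  by exists (fun a b c => tr (a, b, c)) => a b c; exact: (trP (a, b, c)).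
pose s := fix s (i j : nat) {struct j} :=
  if j is j'.+1 then tr (s i j') (v i j') (v i j) else x (i %/ M)%N.
have divT i : (i <= T * M)%N -> (i %/ M <= T)%N.
  by move=> iT; rewrite -(mulnK T M0); exact: leq_div2r.
have ovs i j : (i <= T * M)%N -> (j <= m)%N -> lies_over (s i j) (v i j).
  move=> iT; elim: j => [_|j IH jm] /=; first by rewrite (vB i iT).1; apply: ov; exact: divT.
  by have [_ /(_ (IH (ltnW jm)) (vV i j iT jm))[]] := trP (s i j) (v i j) (v i j.+1).
have vert i j : (i <= T * M)%N -> (j < m)%N -> (gdist (s i j) (s i j.+1) <= D * C')%N.
  move=> iT jm /=.
  by have [_ /(_ (ovs i j iT (ltnW jm)) (vV i j iT jm))[]] := trP (s i j) (v i j) (v i j.+1).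
have DC : (D * C' <= h)%N by rewrite leq_mul2r leqnSn orbT.
(* Transporting [s i j.+1] horizontally gives [z] over the same vertex as [s i.+1 j.+1]. Around the
   square these two are within [3 * D * C' + h], hence within [C'], which restores the bound [h] for
   the next row without growth. *)
have horiz i j : (i < T * M)%N -> (j <= m)%N -> (gdist (s i j) (s i.+1 j) <= h)%N.
  move=> iT; elim: j => [_|j IH jm].
    rewrite /=; have [->|e] := divn_succ i M0; first by rewrite gdistxx.
    have iM : (i %/ M < T)%N by rewrite -e; exact: divT.
    by rewrite e; apply: leq_trans (xC _ iM) _; rewrite /h mulSn leq_addr.
  have [z [dz oz]] := over_transport (ovs i j.+1 (ltnW iT) jm) (vH i j.+1 iT jm).
  have d1 := vert i j (ltnW iT) jm; have d2 := vert i.+1 j iT jm.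
  have d3 := IH (ltnW jm).
  have t1 := gdist_triangle cX (s i j) (s i j.+1) (s i.+1 j).
  have t2 := gdist_triangle cX (s i.+1 j) (s i j.+1) (s i.+1 j.+1).
  have t3 := gdist_triangle cX (s i j.+1) z (s i.+1 j.+1).
  have t4 := gdist_triangle cX z (s i j.+1) (s i.+1 j.+1).
  rewrite (gdistC cX (s i j.+1) (s i j)) in t1; rewrite (gdistC cX z (s i j.+1)) in t3.
  have dzz : (gdist z (s i.+1 j.+1) <= C')%N.
    by apply: (over_unique oz (ovs i.+1 j.+1 iT jm)); lia.
  by have hE : h = (C' + D * C')%N := mulSn _ _; lia.
have s0 j : s 0%N j = x 0%N.
  elim: j => [|j IH]; rewrite /= ?div0n// (trP _ _ _).1//.
  by rewrite (vS j).1 (vS j.+1).1.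
have sT j : s (T * M)%N j = x T.
  elim: j => [|j IH]; rewrite /= ?mulnK// (trP _ _ _).1//.
  by rewrite (vS j).2 (vS j.+1).2.
have hr' : (C' + h <= r)%N by apply: leq_trans hr; rewrite leq_add2r; nia.
(* All top points lie over [y 0]. A step of length [h] from a point within [C'] of [x 0] ends within
   [r] of [x 0], hence again within [C']. *)
have top i : (i <= T * M)%N -> (gdist (x 0%N) (s i m) <= C')%N.
  elim: i => [_|i IH iT]; first by rewrite s0 gdistxx.
  have o0 : lies_over (x 0%N) (y 0%N) by apply: ov.
  have o1 : lies_over (s i.+1 m) (y 0%N) by rewrite -(vB _ iT).2; exact: ovs.
  apply: (over_unique o0 o1).
  have := gdist_triangle cX (s i m) (x 0%N) (s i.+1 m).
  by have := horiz i m iT (leqnn m); have := IH (ltnW iT); lia.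
have C'h : (C' <= h)%N by rewrite /h mulSn leq_addr.
split; first by rewrite -(sT m); apply: top.
have rowE j : (j <= m)%N -> (\prod_(i < T * M) gam (s i 0) (s i.+1 0) =
    \prod_(i < T * M) gam (s i j) (s i.+1 j))%g.
  elim: j => // j IH jm; rewrite IH; last exact: ltnW.
  (* A strip of [n] squares between two rows; at full width both vertical sides have trivial [gam],
     because the lifted sides are constant. *)
  have sq n : (n <= T * M)%N ->
      (\prod_(i < n) gam (s i j) (s i.+1 j) * gam (s n j) (s n j.+1) =
       gam (s 0 j) (s 0 j.+1) * \prod_(i < n) gam (s i j.+1) (s i.+1 j.+1))%g.
    elim: n => [_|n IHn nT]; first by rewrite !big_ord0 mul1g mulg1.
    rewrite !big_ord_recr -!mulgA.
    rewrite [RHS]mulgA -IHn; last exact: ltnW.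
    rewrite -mulgA; congr (_ * _)%g.
    have v1 := leq_trans (vert n j (ltnW nT) jm) DC.
    have v2 := leq_trans (vert n.+1 j nT jm) DC.
    rewrite gamM//; last exact: (horiz n j nT (ltnW jm)).
    by rewrite gamM//; exact: (horiz n j.+1 nT jm).
  by have := sq (T * M)%N (leqnn _); rewrite !s0 !sT !gam1 mul1g mulg1.
have topE n : (n <= T * M)%N ->
    (\prod_(i < n) gam (s i m) (s i.+1 m) = gam (x 0) (s n m))%g.
  elim: n => [_|n IHn nT]; first by rewrite big_ord0 s0 gam1.
  rewrite big_ord_recr /= IHn; last exact: ltnW.
  rewrite gamM//; last exact: horiz.
  by apply: leq_trans (top n (ltnW nT)) _.
have botE n : (\prod_(i < n) gam (s i 0) (s i.+1 0) =
    \prod_(i < n %/ M) gam (x i) (x i.+1))%g.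
  elim: n => [|n IHn]; first by rewrite div0n !big_ord0.
  rewrite big_ord_recr IHn /=; have [->|->] := divn_succ n M0.
    by rewrite gam1 mulg1.
  by rewrite [RHS]big_ord_recr.
by have := botE (T * M)%N; rewrite mulnK// => <-; rewrite (rowE m)// topE// sT.
Qed.
End Lifting.

(** * Products along closed walks *)

Section WalkProduct.
Variables (X : sgraph) (G : groupType) (e : X -> X -> G).
Implicit Types (x y z : X) (p q : seq X).

Fixpoint walk_prod x p : G :=
  if p is y :: p' then (e x y * walk_prod y p')%g else 1%g.

Lemma walk_prod_cat x p q :
  walk_prod x (p ++ q) = (walk_prod x p * walk_prod (last x p) q)%g.
Proof. by elim: p x => [|y p IH] x /=; rewrite ?mul1g// IH mulgA. Qed.

Lemma walk_prodE x p : walk_prod x p =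
  (\prod_(i < size p) e (nth x (x :: p) i) (nth x (x :: p) i.+1))%g.
Proof.
elim: p x => [|y p IH] x /=; first by rewrite big_ord0.
rewrite big_ord_recl /= IH; congr (_ * _)%g; apply: eq_bigr => i _ /=.
by congr (e _ _); apply: set_nth_default; rewrite /= ?ltnS// ltnW.
Qed.

Lemma walk_prod_rot i (c : loop X) : last c.1 c.2 = c.1 ->
  walk_prod (rot_loop i c).1 (rot_loop i c).2 = 1%g -> walk_prod c.1 c.2 = 1%g.
Proof.
case: c => x p /=; rewrite /rot; move: (take i p) (drop i p) (cat_take_drop i p).
move=> p1 p2 <-; rewrite !walk_prod_cat !last_cat.
case: p1 => [|a p1] /=; first by move=> ->; rewrite mulg1 mul1g.
move=> l2; rewrite l2 /= => h.
have : (walk_prod (last a p1) p2)^-1%g = (e x a * walk_prod a p1)%g by exact/mulg1_eq.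
by move=> <-; rewrite mulVg.
Qed.

Lemma last_last x p : last (last x p) p = last x p.
Proof. by case: p. Qed.

Lemma simple_loop_rot i (c : loop X) : simple_loop c -> simple_loop (rot_loop i c).
Proof.
case: c => x p [/= xp lp up]; split=> /=; rewrite ?last_last ?rot_uniq//.
by rewrite -cycle_path rot_cycle (cycle_path x) lp.
Qed.

Lemma rot_comp (T : Type) i j (s : seq T) : exists n, rot j (rot i s) = rot n s.
Proof.
have [i_s|/ltnW si] := leqP i (size s); last by exists j; rewrite [rot i s]rot_oversize.
have [j_s|/ltnW sj] := leqP j (size s); last first.
  by exists i; rewrite rot_oversize// size_rot.
by eexists; exact: rot_add_mod.
Qed.

Lemma rot_loop_comp i j (c : loop X) : exists n, rot_loop j (rot_loop i c) = rot_loop n c.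
Proof.
case: c => x p; have [n en] := rot_comp i j p; exists n.
rewrite /rot_loop /= en; congr pair.
by case: p {en} => // a p; have := size_rot n (a :: p); case: (rot n _).
Qed.

Lemma rot_loop_inv i (c : loop X) : last c.1 c.2 = c.1 ->
  exists n, rot_loop n (rot_loop i c) = c.
Proof.
case: c => x p /= lp; exists (size (rot i p) - i)%N.
rewrite /rot_loop /=.
have -> : rot (size (rot i p) - i) (rot i p) = p by rewrite -/(rotr i _) rotK.
by congr pair; case: p lp => //= a p <-; rewrite last_last.
Qed.

Lemma xget_default (T : choiceType) (a b : T) (A : set T) :
  A !=set0 -> xget a A = xget b A.
Proof.
move=> [t At]; rewrite /xget; case: pselect => // h; case: h.
by exists t; exact/asboolP.
Qed.

Lemma loop_rep_rot (c : loop X) : exists i, loop_rep c = rot_loop i c.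
Proof.
apply: (@xgetPex _ c [set d | exists i, d = rot_loop i c]).
by exists (rot_loop 0 c), 0%N.
Qed.

(** A loop and its representative have the same set of rotations. On a nonempty set [xget] ignores
    its default, which is the only other place where the loop enters. *)
Lemma loop_rep_id (c : loop X) : last c.1 c.2 = c.1 ->
  loop_rep (loop_rep c) = loop_rep c.
Proof.
move=> lc; have [i ei] := loop_rep_rot c.
have e' : [set d | exists j, d = rot_loop j (loop_rep c)] =
    [set d | exists j, d = rot_loop j c].
  rewrite ei; apply/seteqP; split=> d [j ->].
    by have [n ->] := rot_loop_comp i j c; exists n.
  have [n en] := rot_loop_inv i lc.
  by have [n' en'] := rot_loop_comp n j (rot_loop i c); exists n'; rewrite -en' en.
by rewrite {1}/loop_rep e'; apply: xget_default; exists (rot_loop 0 c), 0%N.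
Qed.

Variable l : nat.
Hypothesis face1 : forall c : loop X, face l c -> walk_prod c.1 c.2 = 1%g.

Lemma simple_loop_prod (c : loop X) : simple_loop c -> (size c.2 <= l)%N ->
  walk_prod c.1 c.2 = 1%g.
Proof.
move=> sc cl; have [i ei] := loop_rep_rot c; have lc : last c.1 c.2 = c.1 by case: sc.
apply: (walk_prod_rot (i := i) lc); apply: face1; split.
- exact: simple_loop_rot.
- by rewrite size_rot.
- by rewrite -ei loop_rep_id.
Qed.

(** A vertex repeated in [p] cuts off a closed subwalk, and both pieces are shorter. Without
    repetition the walk is a simple loop; this includes an edge traversed forth and back, a loop of
    length 2, so backtracking needs no separate case. *)
Lemma closed_walk_prod x p : path adj x p -> last x p = x -> (size p <= l)%N ->
  walk_prod x p = 1%g.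
Proof.
have [n] := ubnP (size p); elim: n x p => // n IH x p pn xp lp pl.
have [up|nup] := boolP (uniq p); first exact: (simple_loop_prod (c := (x, p))).
have [a [p1 [p2 [p3 ep]]]] : exists a p1 p2 p3, p = p1 ++ a :: p2 ++ a :: p3.
  move: nup; rewrite -[p]/(id p); clear; elim: p => //= b p IH.
  rewrite negb_and negbK => /orP[|/IH[a [p1 [p2 [p3 ->]]]]].
    by move=> /splitPr[p2 p3]; exists b, [::], p2, p3.
  by exists a, (b :: p1), p2, p3.
move: xp lp pl pn; rewrite ep cat_path /= cat_path /= !last_cat /= last_cat /=.
move=> /and5P[xp1 lpa ap2 l2a ap3] l3 pl pn.
rewrite !size_cat /= size_cat /= in pl pn.
have e2 : walk_prod a (rcons p2 a) = 1%g.
  apply: IH; rewrite ?size_rcons ?last_rcons ?rcons_path ?ap2//; lia.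
have e13 : walk_prod x (rcons p1 a ++ p3) = 1%g.
  apply: IH; rewrite ?last_cat ?last_rcons ?size_cat ?size_rcons//; try lia.
  by rewrite cat_path rcons_path xp1 lpa last_rcons.
rewrite -e13 -!cat_rcons !walk_prod_cat last_rcons /=; congr (_ * _)%g.
by rewrite e2 last_rcons mul1g.
Qed.

Hypothesis cX : graph_connected X.

Let geodesic x y : {p : seq X | [/\ path adj x p, last x p = y & size p = gdist x y]}.
Proof. by apply: cid; exact: gdist_walk. Qed.

(** Extends [e] from edges to all pairs along chosen geodesics. At distances small against [l] it is
    multiplicative, as the lifting argument demands of [gam]. *)
Definition geodesic_prod x y : G := walk_prod x (sval (geodesic x y)).

Lemma geodesic_prodV x y : (2 * gdist x y <= l)%N ->
  (geodesic_prod x y * geodesic_prod y x)%g = 1%g.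
Proof.
move=> d; rewrite /geodesic_prod.
case: (geodesic x y) => p [xp lp sp]; case: (geodesic y x) => q [yq lq sq] /=.
rewrite -{1}lp -walk_prod_cat; apply: closed_walk_prod.
- by rewrite cat_path xp lp.
- by rewrite last_cat lp.
- by rewrite size_cat sp sq (gdistC cX y); lia.
Qed.

(** The three geodesics form a closed walk whose third side is bounded by the sum of the other two,
    whence the factor 2. *)
Lemma geodesic_prodM x y z : (2 * (gdist x y + gdist y z) <= l)%N ->
  (geodesic_prod x y * geodesic_prod y z)%g = geodesic_prod x z.
Proof.
move=> d; have dt := gdist_triangle cX y x z.
apply: (mulIg (geodesic_prod z x)); rewrite geodesic_prodV; last lia.
rewrite /geodesic_prod.
case: (geodesic x y) => p [xp lp sp]; case: (geodesic y z) => q [yq lq sq].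
case: (geodesic z x) => s [zs ls ss] /=.
rewrite -[in walk_prod y]lp -walk_prod_cat.
have -> : z = last x (p ++ q) by rewrite last_cat lp.
rewrite -walk_prod_cat; apply: closed_walk_prod.
- by rewrite !cat_path xp lp yq last_cat lp lq.
- by rewrite !last_cat lp lq.
- by rewrite !size_cat sp sq ss (gdistC cX z); lia.
Qed.

Lemma geodesic_prod1 x : geodesic_prod x x = 1%g.
Proof.
rewrite /geodesic_prod; case: (geodesic x x) => p [xp lp sp] /=.
by move: sp; rewrite gdistxx// => /size0nil ->.
Qed.

Lemma geodesic_prod_adj x y : (2 <= l)%N -> adj x y -> geodesic_prod x y = e x y.
Proof.
move=> l2 xy; have d1 : (gdist x y <= 1)%N by apply: gdist_le; exact: walk_adj.
apply: (mulIg (geodesic_prod y x)); rewrite geodesic_prodV; last lia.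
rewrite /geodesic_prod; case: (geodesic y x) => p [yp lp sp] /=.
symmetry; apply: (closed_walk_prod (p := y :: p)) => /=; rewrite ?xy//.
by rewrite sp gdistC//; lia.
Qed.
End WalkProduct.

(** * Potentials from trivial closed walks *)

Section Potential.
Variables (X : sgraph) (G : groupType) (e : X -> X -> G).

(** [phi x] is the product along a chosen walk from [x0] to [x]. The walk to [x] followed by the
    edge to [y], and the walk to [y], are closed up by the same return walk [w' y]. Return walks are
    chosen separately because [e y x] is not by definition the inverse of [e x y]. *)
Lemma closed_walk_potential (x0 : X) : graph_connected X ->
  (forall x p, path adj x p -> last x p = x -> walk_prod e x p = 1%g) ->
  exists phi : X -> G, forall x y, adj x y -> e x y = ((phi x)^-1 * phi y)%g.
Proof.
move=> cX h.
have /choice[w wP] : forall x, exists p, path adj x0 p /\ last x0 p = x.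
  by move=> x; have [n [p [? ? _]]] := cX x0 x; exists p.
have /choice[w' wP'] : forall x, exists p, path adj x p /\ last x p = x0.
  by move=> x; have [n [p [? ? _]]] := cX x x0; exists p.
exists (fun x => walk_prod e x0 (w x)) => x y xy.
have [wx lx] := wP x; have [wy ly] := wP y; have [wy' ly'] := wP' y.
apply: (mulgI (walk_prod e x0 (w x))); rewrite mulVKg.
apply: (mulIg (walk_prod e y (w' y))).
have cat x1 p y1 q : last x1 p = y1 ->
    (walk_prod e x1 p * walk_prod e y1 q)%g = walk_prod e x1 (p ++ q).
  by move=> <-; rewrite walk_prod_cat.
rewrite (cat _ _ y _ ly) [RHS]h; last 2 first.
- by rewrite cat_path wy ly.
- by rewrite last_cat ly.
rewrite -mulgA -[(e x y * _)%g]/(walk_prod e x (y :: w' y)) (cat _ _ x _ lx) h//.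
  by rewrite cat_path wx lx /= xy.
by rewrite last_cat /=.
Qed.
End Potential.

(** * Contractible charts *)

Section LocalPotential.
Variables (R : realType) (T : topologicalType) (x0 : T) (pcT : path_connected R T).
Local Notation cl := (path_class x0 pcT).

(** [E t] compares the class of [g] on [0, t] with [Phi (g t)]. It is locally constant by the local
    hypothesis, so its level set through 0 is open and closed in the line, and [E 0 = E 1]. *)
Lemma path_class_potential (Phi : T -> pi1 R x0) :
  (forall p, exists W : set T, [/\ open W, W p &
     forall a : R -> T, continuous a -> (forall s, W (a s)) ->
       cl a = ((Phi (a 0%R))^-1 * Phi (a 1%R))%g]) ->
  forall g : R -> T, continuous g -> cl g = ((Phi (g 0%R))^-1 * Phi (g 1%R))%g.
Proof.
move=> loc g cg.
pose F (q : R * R) := g q.1.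
have cF : continuous F by apply: (continuous_compose cg); continuity.
pose E (t : R) := (cl (segment_path F (0%R, 0%R) (t, 0%R)) * (Phi (g t))^-1)%g.
have Eloc t0 : \forall t \near t0, E t = E t0.
  have [W [oW Wp hW]] := loc (g t0).
  have : nbhs t0 (g @^-1` W) by apply: cg; exact: open_nbhs_nbhs.
  move=> /nbhs_ballP[e /= e0 be]; apply/nbhs_ballP; exists e => //= t bt.
  rewrite /E -(path_class_triangle _ _ (0, 0) (t0, 0) (t, 0) cF) -mulgA; congr (_ * _)%g.
  pose a (s : R) := segment_path F (t0, 0) (t, 0) (clamp s).
  have ca : continuous a.
    exact: (continuous_compose (h := segment_path F (t0, 0) (t, 0))
      (segment_path_continuous cF) (@clamp_continuous R)).
  have -> : cl (segment_path F (t0, 0) (t, 0)) = cl a.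
    apply: path_class_ext => //; first exact: segment_path_continuous.
    by move=> s s01; rewrite /a clampE.
  rewrite hW//; last first.
    move=> s; rewrite /a /segment_path /F /=; apply: be; rewrite /ball /= in bt *.
    have /andP[c0 c1] := clamp01 s; set d := clamp s in c0 c1 *.
    rewrite (_ : _ - _ = d * (t0 - t)); last by ring.
    by rewrite normrM ger0_norm//; apply: le_lt_trans bt; rewrite ler_piMl.
  by rewrite /a clamp0 clamp1 segment_path0 segment_path1 /F /= mulgK.
have EE : E 0 = E 1.
  pose B : set R := [set t | E t = E 0].
  have oB : open B.
    rewrite openE => t Bt; rewrite /interior; near=> t'.
    by rewrite /B/= -Bt; near: t'; exact: Eloc.
  have cB : closed B.
    rewrite -openC openE => t Bt; rewrite /interior; near=> t' => Bt'; apply: Bt.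
    by rewrite /B/= -Bt'; symmetry; near: t'; exact: Eloc.
  have : B = setT.
    have /connected_intervalP : is_interval [set: R] by [].
    by apply; [exists 0|exists B => //; rewrite setTI|exists B => //; rewrite setTI].
  by move=> BT; have : B 1 by rewrite BT.
move: EE; rewrite /E path_class_segment_refl// mul1g => EE.
have -> : cl g = cl (segment_path F (0, 0) (1, 0)).
  apply: path_class_ext => //; first exact: segment_path_continuous.
  by move=> s _; rewrite /segment_path /F /= mulr0 mulr1 add0r.
by rewrite EE mulgVK.
Unshelve. all: by end_near. Qed.
End LocalPotential.

(** The tube lemma, with time as the compact factor. *)
Lemma near_compact_param (R : realType) (Z T : topologicalType) (F : Z * R -> T)
    (O : set T) (J : set R) (z : Z) : compact J -> open O -> continuous F ->
  (forall t, J t -> O (F (z, t))) -> \forall z' \near z, forall t, J t -> O (F (z', t)).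
Proof.
move=> /compact_near_coveringP cJ oO cF h.
apply: (cJ Z (nbhs z) (fun z' t => O (F (z', t)))) => t Jt.
have : nbhs (z, t) (F @^-1` O) by apply: cF; apply: open_nbhs_nbhs; split=> //; exact: h.
case=> -[A B] /= [zA tB] AB; exists (B, A) => //= -[t' z'] /= [Bt' Az'].
exact: (AB (z', t')).
Qed.

Section Charts.
Variables (R : realType) (k : nat) (X : sgraph).
Local Notation P := (polygonal_complex R k X).
Variables (W : set P) (K : P -> R -> P) (w : P).

(* The contraction [K] of [W] is read in the characteristic maps of the cells. *)
Definition cellwise_continuous (Z : topologicalType) (phi : Z -> P) :=
  forall z, W (phi z) -> exists F : Z * R -> P, continuous F /\
    \forall z' \near z, W (phi z') ->
      forall t, 0 <= t <= 1 -> K (phi z') t = F (z', t).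

(** The tracks of [K] may leave [W]: contractibility in the whole complex suffices. [chart_vertex]
    covers points presented by degenerate edges, about which [chart_edge] says nothing. *)
Record chart_spec : Prop := ChartSpec {
  chart_open : open W;
  chart0 : forall p, W p -> K p 0 = p;
  chart1 : forall p, W p -> K p 1 = w;
  chart_edge : forall u v, adj u v -> cellwise_continuous (edge_path u v);
  chart_face : forall c, face k c -> cellwise_continuous (face_path c);
  chart_vertex : forall u, W (edge_path u u 0) ->
    forall t, K (edge_path u u 0) t = edge_path u u 0
}.

Hypothesis chW : chart_spec.

Let tube_preimage (Z : topologicalType) (phi : Z -> P) (O : set P) (J : set R) :
  continuous phi -> cellwise_continuous phi -> open O -> compact J ->
  open (phi @^-1` [set p | W p /\ forall t, J t -> O (K p (clamp t))]).
Proof.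
move=> cphi cw oO cJ; rewrite openE => z /= [Wz Oz]; rewrite /interior.
have [F [cF nF]] := cw z Wz.
have cFc : continuous (fun q : Z * R => F (q.1, clamp q.2)).
  by apply: (continuous_compose cF); continuity.
have := near_compact_param (z := z) cJ oO cFc.
have FE t : F (z, clamp t) = K (phi z) (clamp t).
  by symmetry; apply: (nbhs_singleton nF) => //; exact: clamp01.
have Oz' t : J t -> O (F (z, clamp t)) by move=> Jt; rewrite FE; exact: Oz.
move=> /(_ Oz') nO; near=> z'; have Wz' : W (phi z').
  by near: z'; apply: cphi; apply: open_nbhs_nbhs; split=> //; exact: (chart_open chW).
have KF : W (phi z') -> forall t, 0 <= t <= 1 -> K (phi z') t = F (z', t) by near: z'.
have OF : forall t, J t -> O (F (z', clamp t)) by near: z'.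
by split=> // t Jt; rewrite KF ?clamp01//; exact: OF.
Unshelve. all: by end_near. Qed.

(** The final topology tests openness on cells for subsets of the complex, not of its product with
    time. A tube is such a subset, and the tube lemma applies in each cell. *)
Lemma chart_tube_open (O : set P) (J : set R) : open O -> compact J ->
  open [set p | W p /\ forall t, J t -> O (K p (clamp t))].
Proof.
move=> oO cJ; apply: complex_openP => [u v uv|c fc]; apply: tube_preimage => //.
- by apply: edge_path_continuous; rewrite /lazy_adj uv orbT.
- exact: chart_edge.
- exact: face_path_continuous.
- exact: chart_face.
Qed.

Lemma chart_track_continuous p : W p -> continuous (fun t => K p (clamp t)).
Proof.
have aux (Z : topologicalType) (phi : Z -> P) z :
    cellwise_continuous phi -> W (phi z) -> continuous (fun t => K (phi z) (clamp t)).
  move=> cw Wz; have [F [cF nF]] := cw z Wz.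
  rewrite (_ : (fun t => _) = fun t => F (z, clamp t)).
    by apply: (continuous_compose cF); continuity.
  by apply/funext => t; apply: (nbhs_singleton nF) => //; exact: clamp01.
have [[u [v [x [uv x01 ->]]]]|[c [q [fc q1 q2 ->]]]] := complex_pointP p; last first.
  by apply: aux; exact: chart_face.
case/orP : uv => [/eqP <-|uv]; last by apply: aux; exact: chart_edge.
have -> : edge_path u u x = edge_path u u 0 :> P.
  apply: polygonal_complex_eq.
  by rewrite !val_edge_path ?/lazy_adj ?eqxx// !segment_point_refl.
move=> Wu; rewrite (_ : (fun t => _) = fun=> edge_path u u 0); first exact: continuous_const.
by apply/funext => t; exact: chart_vertex.
Qed.

(** The track of [a s0] keeps a compact time interval around [t0] inside [O]. The tube over that
    interval is open, so its preimage under [a] times a ball in time is the required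
    neighbourhood. *)
Lemma chart_homotopy_continuous (a : R -> P) : continuous a -> (forall s, W (a s)) ->
  continuous (fun q : R * R => K (a q.1) (clamp q.2)).
Proof.
move=> ca Wa [s0 t0] O0 /=; rewrite nbhsE => -[O [oO Op] OO0].
have := chart_track_continuous (Wa s0).
move=> /(_ t0 O (open_nbhs_nbhs (conj oO Op))) /nbhs_ballP[e /= e0 be].
pose J : set R := `[t0 - e / 2, t0 + e / 2]%classic.
have oB := chart_tube_open oO (@segment_compact _ (t0 - e / 2) (t0 + e / 2)).
set B := [set p | _] in oB.
have Bs0 : B (a s0).
  split=> // t; rewrite /= in_itv/= => /andP[h1 h2]; apply: be.
  by rewrite /ball /= ltr_norml; lra.
exists (a @^-1` B, ball t0 (e / 2)).
  split; first by apply: ca; exact: open_nbhs_nbhs.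
  by apply: nbhsx_ballx; lra.
move=> [s t] [/= [Was h] bt]; apply: OO0; apply: h.
rewrite /= in_itv/=; move: bt; rewrite /ball /= ltr_norml => /andP[h1 h2].
by apply/andP; split; lra.
Qed.

Variables (x0 : P) (pcP : path_connected R P).
Local Notation cl := (path_class x0 pcP).

Definition chart_class p := cl (fun t => K p (clamp t)).

(** The square [K (a s) t] has [a] as its bottom, the tracks of the ends of [a] as vertical sides
    and a constant top. *)
Lemma chart_path_class (a : R -> P) : continuous a -> (forall s, W (a s)) ->
  cl a = (chart_class (a 0%R) * (chart_class (a 1%R))^-1)%g.
Proof.
move=> ca Wa; have cF := chart_homotopy_continuous ca Wa.
set F := fun q : R * R => K (a q.1) (clamp q.2) in cF.
have e1 : cl a = cl (segment_path F (0, 0) (1, 0)).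
  apply: path_class_ext => //; first exact: segment_path_continuous.
  move=> s _; rewrite /segment_path /F /= !mulr0 mulr1 !add0r clamp0.
  by rewrite (chart0 chW).
have e2 x : chart_class (a x) = cl (segment_path F (x, 0) (x, 1)).
  apply: path_class_ext; [exact: chart_track_continuous|exact: segment_path_continuous|].
  move=> s _; rewrite /segment_path /F /= !mulr0 mulr1 !add0r.
  by rewrite -mulrDl subrK mul1r.
have e3 : cl (segment_path F (0, 1) (1, 1)) = 1%g.
  rewrite -(path_class_cst x0 pcP w).
  apply: path_class_ext; [exact: segment_path_continuous|exact: continuous_const|].
  move=> s _; rewrite /segment_path /F /= !mulr1 subrK clamp1 (chart1 chW)//.
rewrite e1 !e2 -(path_class_triangle _ _ (0, 0) (0, 1) (1, 0) cF).
rewrite -(path_class_triangle _ _ (0, 1) (1, 1) (1, 0) cF) e3 mul1g.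
by rewrite -(path_class_segmentV _ _ _ _ cF).
Qed.
End Charts.

(** * Open faces are contractible charts *)

Section Polar.
Variable R : realType.
Implicit Types r s : R.

Lemma cos_2pi_eq1 s : 0 <= s <= 1 -> cos (2 * pi * s) = 1 -> s = 0 \/ s = 1.
Proof.
move=> /andP[s0 s1] h.
have [->|sn0] := eqVneq s 0; first by left.
have [->|sn1] := eqVneq s 1; first by right.
have {}s0 : 0 < s by rewrite lt_neqAle eq_sym sn0.
have {}s1 : s < 1 by rewrite lt_neqAle sn1.
have p0 := pi_gt0 R.
have : 0 < sin (pi * s) by apply: sin_gt0_pi; rewrite mulr_gt0//= gtr_pMr.
have e : 2 * pi * s = (pi * s) *+ 2 by rewrite -mulr_natl; ring.
move: h; rewrite e cos_mulr2n cos2sin2 => h hs; exfalso.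
have : sin (pi * s) ^+ 2 = 0 by move: h; rewrite !mulr2n; lra.
by move/eqP; rewrite sqrf_eq0 gt_eqF.
Qed.

Definition same_angle s s' := s = s' \/ (s = 0 /\ s' = 1) \/ (s = 1 /\ s' = 0).

Lemma polar_inj r r' s s' : 0 < r -> 0 < r' -> 0 <= s <= 1 -> 0 <= s' <= 1 ->
  r * cos (2 * pi * s) = r' * cos (2 * pi * s') ->
  r * sin (2 * pi * s) = r' * sin (2 * pi * s') -> r = r' /\ same_angle s s'.
Proof.
move=> r0 r'0 s01 s'01 ec es.
have er : r = r'.
  have : r ^+ 2 = r' ^+ 2.
    have sq (a b : R) : a ^+ 2 = (a * cos b) ^+ 2 + (a * sin b) ^+ 2.
      by rewrite !exprMn -mulrDr cos2Dsin2 mulr1.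
    by rewrite (sq r (2 * pi * s)) ec es -sq.
  by move/eqP; rewrite eqrXn2 ?ltW// => /eqP.
split=> //; subst r'; have rn : r != 0 by rewrite gt_eqF.
move/(mulfI rn) : ec => ec; move/(mulfI rn) : es => es.
wlog ss : s s' s01 s'01 ec es / s' <= s => [h|].
  have [/h|/ltW /h] := leP s' s; first exact.
  by case=> // [->|[[-> ->]|[-> ->]]]; rewrite /same_angle; tauto.
have : cos (2 * pi * (s - s')) = 1.
  by rewrite mulrBr cosB ec es -!expr2 cos2Dsin2.
move/cos_2pi_eq1 => [|e|e]; rewrite /same_angle; first by lra.
  by left; lra.
by right; right; lra.
Qed.

Lemma cos_2pi1 : cos (2 * pi * 1) = cos (2 * pi * 0) :> R.
Proof. by rewrite mulr1 mulr0 cos0 mulr_natl cos2pi. Qed.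

Lemma sin_2pi1 : sin (2 * pi * 1) = sin (2 * pi * 0) :> R.
Proof. by rewrite mulr1 mulr0 sin0 mulr_natl sin2pi. Qed.
End Polar.

Section FaceSeam.
Variables (R : realType) (k : nat) (X : sgraph).
Local Notation P := (polygonal_complex R k X).
Implicit Types (u v w : X) (c : loop X) (s t : R) (q : R * R).

Lemma face_path_seam c r : face k c -> face_path c (r, 1) = face_path c (r, 0) :> P.
Proof.
move=> fc; apply: polygonal_complex_eq; rewrite !val_face_path//= clamp0 clamp1.
rewrite /face_map /=; case: ifP => _; first by rewrite cos_2pi1 sin_2pi1.
by apply: attach1; case: fc => -[].
Qed.

Lemma face_path_center c s : face k c -> face_path c (0, s) = face_path c (0, 0) :> P.
Proof.
move=> fc; apply: polygonal_complex_eq; rewrite !val_face_path//= clamp0.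
by rewrite /face_map /= ltr01 !mul0r.
Qed.

Lemma face_path_vertex c s i : face k c -> 0 <= s <= 1 ->
  (size c.2)%:R * s = i%:R ->
  face_path c (1, s) = edge_path (nth c.1 (c.1 :: c.2) i) (nth c.1 (c.1 :: c.2) i) 0 :> P.
Proof.
move=> fc s01 e; apply: polygonal_complex_eq.
rewrite val_face_path// val_edge_path ?/lazy_adj ?eqxx//= clamp0 clamp1 clampE//.
by rewrite /face_map ltxx (attach_vertex e).
Qed.

Lemma face_path_edge c i s : face k c -> (i < size c.2)%N -> 0 <= s <= 1 ->
  face_path c (1, (i%:R + s) / (size c.2)%:R) =
  edge_path (nth c.1 (c.1 :: c.2) i) (nth c.1 (c.1 :: c.2) i.+1) s :> P.
Proof.
move=> fc im s01; have /andP[s0 s1] := s01.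
have m0 : 0 < (size c.2)%:R :> R by rewrite ltr0n; exact: leq_ltn_trans im.
have a01 : 0 <= (i%:R + s) / (size c.2)%:R <= 1.
  rewrite divr_ge0 ?addr_ge0// ?ler0n// ler_pdivrMr// mul1r.
  have : i.+1%:R <= (size c.2)%:R :> R by rewrite ler_nat.
  by rewrite -natr1; lra.
apply: polygonal_complex_eq; rewrite val_face_path// val_edge_path; last first.
  by case: fc => -[pc _ _] _ _; rewrite /lazy_adj; apply/orP; right; exact: (pathP c.1 pc).
rewrite /= clamp1 !clampE// /face_map ltxx (attach_segment im s01)//.
by rewrite mulrC divfK// gt_eqF.
Qed.
End FaceSeam.

Section FaceChart.
Variables (R : realType) (k : nat) (X : sgraph).
Local Notation P := (polygonal_complex R k X).
Variables (c : loop X) (fc : face k c).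

Definition open_face : set P := [set p | exists z, sval p = FacePoint c z].

Definition face_contraction (p : P) (t : R) : P :=
  if sval p is FacePoint _ z then to_complex c.1 (FacePoint c ((1 - t) * z.1, (1 - t) * z.2))
  else p.

Lemma open_face_path (c' : loop X) (q : R * R) : face k c' ->
  open_face (face_path c' q) <-> c' = c /\ clamp q.1 < 1.
Proof.
move=> fc'; rewrite /open_face/= val_face_path// /face_map /=.
split=> [[z]|[-> ->]]; last by eexists.
by case: ifP => // h [<-].
Qed.

Lemma open_face_edge u v (x : R) : lazy_adj u v -> ~ open_face (edge_path u v x).
Proof. by move=> uv [z]; rewrite val_edge_path. Qed.

Lemma face_contractionE (q : R * R) (t : R) : clamp q.1 < 1 -> 0 <= t <= 1 ->
  face_contraction (face_path c q) t = face_path c ((1 - t) * clamp q.1, q.2).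
Proof.
move=> q1 t01; have /andP[c0 c1] := clamp01 q.1.
have e01 : 0 <= (1 - t) * clamp q.1 <= 1.
  by rewrite mulr_ge0//=; [apply: mulr_ile1|]; lra.
have lt1 : (1 - t) * clamp q.1 < 1.
  by apply: le_lt_trans q1; rewrite ler_piMl//; lra.
apply: polygonal_complex_eq.
rewrite /face_contraction val_face_path// [RHS]val_face_path// {1}/face_map /= q1.
have e : FacePoint c ((1 - t) * (clamp q.1 * cos (2 * pi * clamp q.2)),
     (1 - t) * (clamp q.1 * sin (2 * pi * clamp q.2))) =
   face_map c ((1 - t) * clamp q.1, clamp q.2).
  by rewrite /face_map /= lt1 !mulrA.
rewrite to_complexK e; first by rewrite (clampE e01).
right; exists c, ((1 - t) * clamp q.1, clamp q.2); split=> //.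
by split; rewrite /= in_itv/= ?e01//; exact: clamp01.
Qed.

Lemma open_faceP (p : P) : open_face p ->
  exists q, [/\ 0 <= q.1 <= 1, 0 <= q.2 <= 1, clamp q.1 < 1 & p = face_path c q].
Proof.
have [[u [v [x [uv _ ->]]]]|[c' [q [fc' q1 q2 ->]]]] := complex_pointP p.
  by move/(open_face_edge uv).
by move/(open_face_path _ fc') => [<- h]; exists q.
Qed.

Lemma face_chart : chart_spec open_face face_contraction (face_path c (0, 0)).
Proof.
split.
- apply: complex_openP => [u v uv|c' fc'].
    rewrite (_ : _ @^-1` _ = set0); first exact: open0.
    apply/seteqP; split=> // x /= /open_face_edge; apply.
    by rewrite /lazy_adj uv orbT.
  have [->|ne] := pselect (c' = c); last first.
    rewrite (_ : _ @^-1` _ = set0); first exact: open0.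
    by apply/seteqP; split=> // q /= /(open_face_path _ fc')[].
  rewrite (_ : _ @^-1` _ = [set q | 0 < 1 - clamp q.1]).
    by apply: open_pos; continuity.
  apply/seteqP; split=> q /=; rewrite subr_gt0; first by move/(open_face_path _ fc) => [].
  by move=> h; apply/(open_face_path _ fc).
- move=> p /open_faceP[q [q1 q2 lt1 ->]].
  rewrite face_contractionE ?lexx ?ler01// subr0 mul1r clampE//.
- move=> p /open_faceP[q [q1 q2 lt1 ->]].
  rewrite face_contractionE ?lexx ?ler01// subrr mul0r.
  exact: face_path_center.
- by move=> u v uv x /open_face_edge; rewrite /lazy_adj uv orbT => /(_ isT).
- move=> c' fc' q /(open_face_path _ fc')[-> lt1].
  exists (fun x => face_path c ((1 - x.2) * clamp x.1.1, x.1.2)); split.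
    by apply: (continuous_compose (face_path_continuous fc)); continuity.
  near=> q' => /(open_face_path _ fc)[_ lt1'] t t01.
  exact: face_contractionE.
- by move=> u /open_face_edge; rewrite /lazy_adj eqxx => /(_ isT).
Unshelve. all: by end_near. Qed.
End FaceChart.

(** * Punctured stars are contractible charts *)

Section ArcEnd.
Variables (R : realType) (X : sgraph).
Implicit Types (u v w : X) (c : loop X) (s t : R).

Lemma attach_coordE c s : 0 <= s <= 1 ->
  attach c s = GraphPoint (fun v => attach_coord c v s).
Proof. exact: attach_hat. Qed.

Lemma attach_coord1 c v : last c.1 c.2 = c.1 ->
  attach_coord c v 1 = attach_coord c v (0 : R).
Proof.
move=> lc; have := attach1 R lc; rewrite !attach_coordE ?lexx ?ler01// => -[e].
exact: (congr1 (fun f => f v) e).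
Qed.

(* The parameter of the vertex [v] on the boundary arc through [s]. On a
   0-gon, whose boundary is constant, every parameter is left in place. *)
Definition arc_end c v s : R :=
  if size c.2 == 0%N then s else
  (xget 0%N [set i | [/\ (i <= size c.2)%N, nth c.1 (c.1 :: c.2) i = v &
      `|(size c.2)%:R * s - i%:R| < 1]])%:R / (size c.2)%:R.

(** Two indices within distance 1 of the same parameter differ by at most one, and consecutive
    vertices of a loop are adjacent, hence distinct by irreflexivity. *)
Lemma arc_index_unique c v s i j : path adj c.1 c.2 ->
  (i <= size c.2)%N -> (j <= size c.2)%N ->
  nth c.1 (c.1 :: c.2) i = v -> nth c.1 (c.1 :: c.2) j = v ->
  `|(size c.2)%:R * s - i%:R| < 1 -> `|(size c.2)%:R * s - j%:R| < 1 -> i = j.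
Proof.
move=> pc; wlog ij : i j / (i <= j)%N => [h im jm wi wj di dj|].
  by have [/h|/ltnW/h h'] := leqP i j; [exact|symmetry; exact: h'].
move=> im jm wi wj di dj; have : j%:R < i.+2%:R :> R.
  rewrite -!natr1; move: di dj; rewrite !ltr_norml; lra.
rewrite ltr_nat => ji; have [//|ne] := eqVneq i j.
have ej : j = i.+1 by lia.
have := pathP c.1 pc i; rewrite ej in jm wj.
move=> /(_ jm); rewrite -/(nth c.1 (c.1 :: c.2) i.+1) wi.
by move: wj => /= ->; rewrite adj_irr.
Qed.

Lemma arc_endE c v s i : path adj c.1 c.2 -> (0 < size c.2)%N ->
  (i <= size c.2)%N -> nth c.1 (c.1 :: c.2) i = v ->
  `|(size c.2)%:R * s - i%:R| < 1 -> arc_end c v s = i%:R / (size c.2)%:R.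
Proof.
move=> pc m0 im wi di; rewrite /arc_end gtn_eqF//; congr (_%:R / _).
apply: xget_unique => // j [jm wj dj].
exact: (arc_index_unique pc jm im wj wi dj di).
Qed.

Lemma arc_end_vertex c v s : path adj c.1 c.2 -> 0 < attach_coord c v s ->
  exists i, [/\ (i <= size c.2)%N, nth c.1 (c.1 :: c.2) i = v &
    (size c.2)%:R * arc_end c v s = i%:R].
Proof.
move=> pc /attach_coord_gt0[i [im wi di]]; exists i; split=> //.
have [m0|m0] := posnP (size c.2).
  by move: im; rewrite m0 leqn0 => /eqP ->; rewrite mul0r.
by rewrite (arc_endE pc m0 im wi di) mulrC divfK// pnatr_eq0 -lt0n.
Qed.

Lemma arc_end01 c v s : path adj c.1 c.2 -> 0 <= s <= 1 -> 0 < attach_coord c v s ->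
  0 <= arc_end c v s <= 1.
Proof.
move=> pc s01 h; have [m0|m0] := posnP (size c.2); first by rewrite /arc_end m0.
have [i [im _ e]] := arc_end_vertex pc h.
have mR : 0 < (size c.2)%:R :> R by rewrite ltr0n.
rewrite -(pmulr_rge0 _ mR) e ler0n /=.
by rewrite -(ler_pM2l mR) e mulr1 ler_nat.
Qed.

(** The arc from [s] to [v] lies in one edge, with [v] as its initial or final end, and there
    barycentric coordinates are affine in the parameter. On the rim of a face this reconciles the
    two branches of [star_contraction]. *)
Lemma attach_arc_end c v s t : path adj c.1 c.2 -> 0 <= s <= 1 ->
  0 < attach_coord c v s -> 0 <= t <= 1 ->
  attach c ((1 - t) * s + t * arc_end c v s) =
  GraphPoint (fun u => (1 - t) * attach_coord c u s + t * (u == v)%:R).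
Proof.
move=> pc s01 h /andP[t0 t1]; have as_ := attach_coordE c s01.
have [i [im wi di]] := attach_coord_gt0 h.
have [m0|m0] := posnP (size c.2).
  have i0 : i = 0%N by move: im; rewrite m0; case: i {wi di}.
  move: wi; rewrite i0 /= => cv; rewrite /arc_end m0 /= -mulrDl subrK mul1r.
  move: as_; rewrite (@attach_vertex _ _ c 0%N s) ?m0 ?mul0r//= segment_point0 => -[e].
  congr GraphPoint; apply/funext => u; rewrite -(congr1 (fun f => f u) e) cv.
  by rewrite -mulrDl subrK mul1r.
have mR : (size c.2)%:R != 0 :> R by rewrite pnatr_eq0 -lt0n.
rewrite (arc_endE pc m0 im wi di).
have am : (size c.2)%:R * ((1 - t) * s + t * (i%:R / (size c.2)%:R)) =
    (1 - t) * ((size c.2)%:R * s) + t * i%:R.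
  by field.
move: di; rewrite ltr_norml => /andP[d1 d2].
have [ims|msi] := leP i%:R ((size c.2)%:R * s).
  pose x := (size c.2)%:R * s - i%:R.
  have x01 : 0 <= x < 1 by rewrite /x; lra.
  have := as_; rewrite (@attachE _ _ c i s x) => //; last by rewrite /x; ring.
  move=> [e].
  rewrite (@attachE _ _ c i _ ((1 - t) * x)); last 2 first.
  - move: x01 => /andP[x0 x1]; rewrite mulr_ge0//=; last lra.
    by apply: le_lt_trans x1; rewrite ler_piMl//; lra.
  - by rewrite am /x; ring.
  congr GraphPoint; apply/funext => u; rewrite -(congr1 (fun f => f u) e).
  by rewrite wi; ring.
have i0 : (0 < i)%N.
  rewrite lt0n; apply/eqP => i0; move: msi; rewrite i0 ltNge mulr_ge0//.
  by case/andP : s01.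
have ej : i = i.-1.+1 by rewrite prednK.
pose x := (size c.2)%:R * s - i.-1%:R.
have iR : i%:R = i.-1%:R + 1 :> R by rewrite natr1 -ej.
have x01 : 0 <= x <= 1 by rewrite /x; lra.
have jm : (i.-1 < size c.2)%N by rewrite -ej.
have := as_; rewrite (attach_segment jm x01); last by rewrite /x; ring.
move=> [e].
rewrite (attach_segment (t := (1 - t) * x + t) jm); last 2 first.
- by nra.
- by rewrite am iR /x; ring.
congr GraphPoint; apply/funext => u; rewrite -(congr1 (fun f => f u) e).
have wi' : nth c.1 c.2 i.-1 = v by rewrite -wi [in RHS]ej.
by rewrite -ej wi wi'; ring.
Qed.
End ArcEnd.

Section VertexChart.
Variables (R : realType) (k : nat) (X : sgraph) (v : X).
Local Notation P := (polygonal_complex R k X).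

Lemma face_map_boundary (c : loop X) (s : R) : face_map c (1, s) = attach c s.
Proof. by rewrite /face_map /= ltxx. Qed.

Definition polar_near (c : loop X) (z : R * R) : set (R * R) :=
  [set q | [/\ 0 < q.1 < 1, 0 <= q.2 <= 1,
    z = (q.1 * cos (2 * pi * q.2), q.1 * sin (2 * pi * q.2)) &
    0 < attach_coord c v q.2]].

(** Of a face only the open sector facing [v] remains, without the centre, whose polar angle is
    undetermined; on a 0-gon this is the whole punctured disc. *)
Definition punctured_star : set P := [set p | match sval p with
  | GraphPoint phi => 0 < phi v
  | FacePoint c z => polar_near c z !=set0
  end].

(* In polar coordinates a point moves straight to the parameter of [v] on the
   boundary circle. *)
Definition star_contraction (p : P) (t : R) : P :=
  match sval p with
  | GraphPoint phi =>
      to_complex v (GraphPoint (fun u => (1 - t) * phi u + t * (u == v)%:R))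
  | FacePoint c z =>
      let q := xget (0, 0) (polar_near c z) in
      face_path c ((1 - t) * q.1 + t, (1 - t) * q.2 + t * arc_end c v q.2)
  end.

Lemma polar_near_unique (c : loop X) (r s : R) q : 0 <= r -> 0 <= s <= 1 ->
  polar_near c (r * cos (2 * pi * s), r * sin (2 * pi * s)) q ->
  r = q.1 /\ same_angle s q.2.
Proof.
move=> r0 s01 [/andP[q0 q1] q2 [ec es] _].
apply: polar_inj => //; rewrite lt_neqAle r0 andbT eq_sym; apply/eqP => e.
move: ec es; rewrite e !mul0r => /esym/eqP; rewrite mulf_eq0 gt_eqF//= => /eqP ec.
move=> /esym/eqP; rewrite mulf_eq0 gt_eqF//= => /eqP es.
have := cos2Dsin2 (2 * pi * q.2); rewrite ec es expr0n addr0 => /esym/eqP.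
by rewrite oner_eq0.
Qed.

Lemma attach_coord_angle (c : loop X) s s' : last c.1 c.2 = c.1 ->
  same_angle s s' -> attach_coord c v s = attach_coord c v s' :> R.
Proof.
by move=> lc [->//|[[-> ->]|[-> ->]]]; rewrite attach_coord1.
Qed.

Lemma punctured_star_face (c : loop X) q : face k c ->
  punctured_star (face_path c q) <->
  0 < clamp q.1 /\ 0 < attach_coord c v (clamp q.2).
Proof.
move=> fc; rewrite /punctured_star/= val_face_path// /face_map /=.
have lc : last c.1 c.2 = c.1 by case: fc => -[].
have /andP[r0 r1] := clamp01 q.1; have s01 := clamp01 q.2.
case: ifP => [lt1|ge1]; last first.
  rewrite attach_coordE//; split=> [|[]//]; split=> //.
  by apply: lt_le_trans ltr01 _; rewrite leNgt ge1.
split=> [[q' pq']|[r0' h]].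
  have [e sa] := polar_near_unique r0 s01 pq'.
  case: pq' => /andP[q'0 _] _ _; rewrite e q'0; split=> //.
  by rewrite (attach_coord_angle lc sa).
by exists (clamp q.1, clamp q.2); split=> //=; rewrite r0'.
Qed.

(** Makes the choice by [xget] in [star_contraction] harmless. On the seam [v] is the base vertex,
    found at index 0 from the parameter 0 and at the last index from the parameter 1, so both
    versions stay on the seam; on a 0-gon the angle does not move. *)
Lemma same_angle_face (c : loop X) s s' (t r : R) : face k c ->
  0 <= s <= 1 -> 0 <= s' <= 1 -> 0 < attach_coord c v s ->
  same_angle s s' -> 0 <= t <= 1 ->
  face_path c (r, (1 - t) * s + t * arc_end c v s) =
  face_path c (r, (1 - t) * s' + t * arc_end c v s') :> P.
Proof.
move=> fc s01 s'01 h sa t01; have lc : last c.1 c.2 = c.1 by case: fc => -[].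
have pc : path adj c.1 c.2 by case: fc => -[].
have aux : 0 < attach_coord c v (0 : R) ->
    face_path c (r, (1 - t) * 0 + t * arc_end c v 0) =
    face_path c (r, (1 - t) * 1 + t * arc_end c v 1) :> P.
  move=> h0; have h1 : 0 < attach_coord c v (1 : R) by rewrite attach_coord1.
  have [m0|m0] := posnP (size c.2).
    rewrite /arc_end m0 /= !mulr0 !mulr1 subrK addr0.
    by rewrite face_path_seam.
  have v0 : v = c.1.
    have [i [im wi]] := attach_coord_gt0 h0.
    rewrite mulr0 sub0r normrN normr_nat ltrn1 ltnS leqn0 => /eqP i0.
    by rewrite -wi i0.
  rewrite (arc_endE (i := 0%N) pc m0)//; last by rewrite mulr0 subrr normr0 ltr01.
  rewrite (arc_endE (i := size c.2) pc m0)//; last 2 first.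
  - by rewrite -(last_nth c.1) lc.
  - by rewrite mulr1 subrr normr0 ltr01.
  rewrite divff ?pnatr_eq0 -?lt0n// !mulr1 subrK mulr0 mul0r mulr0 addr0.
  by rewrite face_path_seam.
move: h; case: sa => [->//|[[-> ->]|[-> ->]]] h; first exact: aux.
by symmetry; apply: aux; rewrite -attach_coord1.
Qed.

Lemma star_contraction_face (c : loop X) q t : face k c ->
  punctured_star (face_path c q) -> 0 <= t <= 1 ->
  star_contraction (face_path c q) t =
  face_path c ((1 - t) * clamp q.1 + t,
               (1 - t) * clamp q.2 + t * arc_end c v (clamp q.2)).
Proof.
move=> fc Wq t01; have [r0 h] := (punctured_star_face q fc).1 Wq.
have pc : path adj c.1 c.2 by case: fc => -[].
have s01 := clamp01 q.2; have /andP[_ r1] := clamp01 q.1.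
have [lt1|ge1] := ltP (clamp q.1) 1.
  rewrite /star_contraction val_face_path// /face_map /= lt1.
  have [|e sa] := @polar_near_unique c (clamp q.1) (clamp q.2)
     (xget (0, 0) (polar_near c (clamp q.1 * cos (2 * pi * clamp q.2),
        clamp q.1 * sin (2 * pi * clamp q.2)))) (ltW r0) s01.
    apply: xgetPex; exists (clamp q.1, clamp q.2).
    by split=> //=; rewrite r0.
  rewrite -e; symmetry; apply: same_angle_face => //.
  have [|_ + _ _] := @xgetPex _ (0, 0) (polar_near c
    (clamp q.1 * cos (2 * pi * clamp q.2), clamp q.1 * sin (2 * pi * clamp q.2)));
    last by [].
  exists (clamp q.1, clamp q.2); by split=> //=; rewrite r0.
have e1 : clamp q.1 = 1 by apply/le_anti; rewrite r1.
rewrite /star_contraction val_face_path// /face_map e1 ltxx attach_coordE//.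
rewrite mulr1 subrK; apply: polygonal_complex_eq; rewrite val_face_path//= clamp1.
have a01 := arc_end01 pc s01 h.
have b01 : 0 <= (1 - t) * clamp q.2 + t * arc_end c v (clamp q.2) <= 1 by nra.
rewrite (clampE b01) to_complexK. rewrite [RHS]face_map_boundary attach_arc_end//.
right; exists c, (1, (1 - t) * clamp q.2 + t * arc_end c v (clamp q.2)); split=> //.
  by split; rewrite /= in_itv/= ?lexx ?ler01.
by rewrite face_map_boundary attach_arc_end.
Qed.

Lemma punctured_star_edge a b (x : R) : lazy_adj a b ->
  punctured_star (edge_path a b x) <->
  0 < (1 - clamp x) * (v == a)%:R + clamp x * (v == b)%:R.
Proof. by move=> ab; rewrite /punctured_star/= val_edge_path. Qed.

Lemma star_contraction_edge a b (x t : R) : lazy_adj a b ->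
  punctured_star (edge_path a b x) -> 0 <= t <= 1 ->
  star_contraction (edge_path a b x) t =
  edge_path a b ((1 - t) * clamp x + t * (v == b)%:R).
Proof.
move=> ab /(punctured_star_edge _ ab) h t01; have x01 := clamp01 x.
have e : (fun u => (1 - t) * ((1 - clamp x) * (u == a)%:R + clamp x * (u == b)%:R) +
     t * (u == v)%:R) =
     (fun u => (1 - ((1 - t) * clamp x + t * (v == b)%:R)) * (u == a)%:R
     + ((1 - t) * clamp x + t * (v == b)%:R) * (u == b)%:R).
  apply/funext => u; move: h.
  have [->|vb] := eqVneq v b; first by move=> _ /=; rewrite ?mulr1 ?mulr0; ring.
  have [->|va] := eqVneq v a; first by move=> _ /=; rewrite ?mulr1 ?mulr0; ring.
  by rewrite !mulr0 addr0 ltxx.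
have y01 : 0 <= (1 - t) * clamp x + t * (v == b)%:R <= 1.
  by case: (v == b); rewrite ?mulr1 ?mulr0; nra.
apply: polygonal_complex_eq; rewrite [RHS]val_edge_path// clampE//.
rewrite /star_contraction val_edge_path// {1}/segment_point /= e to_complexK//.
exact: is_cell_segment.
Qed.

Lemma vertex_chart : chart_spec punctured_star star_contraction (edge_path v v 0).
Proof.
split.
- apply: complex_openP => [a b ab|c fc].
    have lab : lazy_adj a b by rewrite /lazy_adj ab orbT.
    rewrite (_ : _ @^-1` _ =
        [set x | 0 < (1 - clamp x) * (v == a)%:R + clamp x * (v == b)%:R]).
      by apply: open_pos; continuity.
    by apply/seteqP; split=> x /= /(punctured_star_edge _ lab).
  rewrite (_ : _ @^-1` _ = [set q | 0 < clamp q.1] `&`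
      [set q | 0 < attach_coord c v (clamp q.2)]).
    apply: openI; first by apply: open_pos; continuity.
    apply: open_pos; apply: (continuous_compose (h := attach_coord c v)
      (f := fun q => clamp q.2)); continuity.
    exact: attach_coord_continuous.
  by apply/seteqP; split=> q /= /(punctured_star_face _ fc).
- move=> p; have [[a [b [x [ab x01 ->]]]]|[c [q [fc q1 q2 ->]]]] := complex_pointP p.
    move=> h; rewrite star_contraction_edge ?lexx ?ler01//.
    by rewrite subr0 mul1r mul0r addr0 clampE.
  move=> h; rewrite star_contraction_face ?lexx ?ler01//.
  by rewrite subr0 !mul1r mul0r !addr0 !clampE// -surjective_pairing.
- move=> p; have [[a [b [x [ab x01 ->]]]]|[c [q [fc q1 q2 ->]]]] := complex_pointP p.
    move=> h; rewrite star_contraction_edge ?lexx ?ler01// subrr mul0r add0r mul1r.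
    move/(punctured_star_edge _ ab) : h.
    have [->|vb] := eqVneq v b; first by rewrite edge_path1.
    have [->|va] := eqVneq v a; first by rewrite edge_path0.
    by rewrite !mulr0 addr0 ltxx.
  move=> h; rewrite star_contraction_face ?lexx ?ler01// subrr !mul0r !add0r mul1r.
  have [_ h'] := (punctured_star_face q fc).1 h.
  have pc : path adj c.1 c.2 by case: fc => -[].
  have [i [im wi e]] := arc_end_vertex pc h'.
  by rewrite (face_path_vertex fc _ e) ?wi// arc_end01// clamp01.
- move=> a b ab x Wx; have lab : lazy_adj a b by rewrite /lazy_adj ab orbT.
  exists (fun y => edge_path a b ((1 - y.2) * clamp y.1 + y.2 * (v == b)%:R)); split.
    by apply: (continuous_compose (edge_path_continuous lab)); continuity.
  by near=> x' => Wx' t t01; exact: star_contraction_edge.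
- move=> c fc q Wq; have [_ h] := (punctured_star_face q fc).1 Wq.
  have pc : path adj c.1 c.2 by case: fc => -[].
  have [m0|m0] := posnP (size c.2).
    exists (fun y => face_path c ((1 - y.2) * clamp y.1.1 + y.2,
        (1 - y.2) * clamp y.1.2 + y.2 * clamp y.1.2)); split.
      by apply: (continuous_compose (face_path_continuous fc)); continuity.
    near=> q' => Wq' t t01; rewrite star_contraction_face//.
    by rewrite /arc_end m0.
  have [i [im wi di]] := attach_coord_gt0 h.
  exists (fun y => face_path c ((1 - y.2) * clamp y.1.1 + y.2,
      (1 - y.2) * clamp y.1.2 + y.2 * (i%:R / (size c.2)%:R))); split.
    by apply: (continuous_compose (face_path_continuous fc)); continuity.
  (* Near [q] the index [i] of the occurrence of [v] does not change, so [arc_end] is constant there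
     and the contraction is given by one continuous formula. *)
  have oN : open [set q' : R * R | 0 < 1 - `|(size c.2)%:R * clamp q'.2 - i%:R|].
    by apply: open_pos; continuity.
  have : nbhs q [set q' : R * R | 0 < 1 - `|(size c.2)%:R * clamp q'.2 - i%:R|].
    by apply: open_nbhs_nbhs; split=> //=; rewrite subr_gt0.
  apply: filterS => q' /=; rewrite subr_gt0 => di' Wq' t t01.
  by rewrite star_contraction_face// (arc_endE pc m0 im wi di').
- move=> u Wu t.
  have uu : lazy_adj u u by rewrite /lazy_adj eqxx.
  have vu : v = u.
    move/(punctured_star_edge _ uu): Wu; rewrite clamp0 subr0 mul1r mul0r addr0.
    by case: eqP => //; rewrite ltxx.
  apply: polygonal_complex_eq; rewrite /star_contraction !val_edge_path//.
  rewrite clamp0 segment_point0 /= to_complexK vu.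
    by congr GraphPoint; apply/funext => w; ring.
  left; exists u, u, 0; split; rewrite ?eqxx ?lexx ?ler01// segment_point0.
  by congr GraphPoint; apply/funext => w; ring.
Unshelve. all: by end_near. Qed.
End VertexChart.

(** * Simple connectedness from closed walks *)

Section PathConnected.
Variables (R : realType) (k : nat) (X : sgraph).
Local Notation P := (polygonal_complex R k X).

Definition joined (p q : P) := exists a : R -> P, [/\ continuous a, a 0 = p & a 1 = q].

Lemma joined_sym p q : joined p q -> joined q p.
Proof.
move=> [a [ca a0 a1]]; exists (path_rev a); split; first exact: path_rev_continuous.
  by rewrite /path_rev subr0.
by rewrite /path_rev subrr.
Qed.

Lemma joined_trans q p r : joined p q -> joined q r -> joined p r.
Proof.
move=> [a [ca a0 a1]] [b [cb b0 b1]]; exists (path_cat a b).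
rewrite path_cat0 path_cat1; split=> //; apply: path_cat_continuous => //.
by rewrite a1 b0.
Qed.

Lemma joined_walk u v n : walk u v n -> joined (edge_path u u 0) (edge_path v v 0).
Proof.
move=> [p [up <- _]]; elim: p u up => [|w p IH] u /=.
  by move=> _; exists (fun=> edge_path u u 0); split=> //; exact: continuous_const.
case/andP=> uw wp; apply: joined_trans (IH w wp).
have luw : lazy_adj u w by rewrite /lazy_adj uw orbT.
exists (edge_path u w); split; first exact: edge_path_continuous.
  exact: edge_path0.
exact: edge_path1.
Qed.

Lemma joined_vertex (p : P) : exists u, joined p (edge_path u u 0).
Proof.
have [[u [v [t [uv t01 ->]]]]|[c [q [fc q1 q2 ->]]]] := complex_pointP p.
  exists u; exists (fun s => edge_path u v ((1 - s) * t)); split.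
  - by apply: (continuous_compose (edge_path_continuous uv)); continuity.
  - by rewrite subr0 mul1r.
  - by rewrite subrr mul0r edge_path0.
exists c.1; exists (segment_path (face_path c) q (1, 0)).
rewrite segment_path0 segment_path1; split=> //.
  exact/segment_path_continuous/face_path_continuous.
by rewrite (@face_path_vertex _ _ _ c 0 0%N)// ?mulr0// lexx ler01.
Qed.

Lemma polygonal_path_connected : graph_connected X -> path_connected R P.
Proof.
move=> cX p q; have [u pu] := joined_vertex p; have [v qv] := joined_vertex q.
have [n w] := cX u v.
exact: joined_trans pu (joined_trans (joined_walk w) (joined_sym qv)).
Qed.
End PathConnected.

Section SimplyConnected.
Variables (R : realType) (l : nat) (X : sgraph).
Local Notation P := (polygonal_complex R l X).
Variables (x0 : P) (pcP : path_connected R P).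
Local Notation cl := (path_class x0 pcP).
Implicit Types (u v : X) (c : loop X).

Definition edge_class u v := cl (edge_path u v).

Lemma boundary_class c i : face l c -> (i <= size c.2)%N ->
  cl (segment_path (face_path c) (1, 0) (1, i%:R / (size c.2)%:R)) =
  (\prod_(j < i) edge_class (nth c.1 (c.1 :: c.2) j) (nth c.1 (c.1 :: c.2) j.+1))%g.
Proof.
move=> fc; have cF := face_path_continuous (R := R) fc.
elim: i => [_|i IH im]; first by rewrite mul0r big_ord0 path_class_segment_refl.
rewrite big_ord_recr /= -IH; last exact: ltnW.
rewrite -(path_class_triangle _ _ (1, 0) (1, i%:R / (size c.2)%:R)
  (1, i.+1%:R / (size c.2)%:R))//.
congr (_ * _)%g; apply: path_class_ext; first exact: segment_path_continuous.
  apply: edge_path_continuous; case: fc => -[pc _ _] _ _.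
  by rewrite /lazy_adj; apply/orP; right; exact: (pathP c.1 pc).
move=> s s01; rewrite -face_path_edge// /segment_path /=; congr (face_path _ (_, _)).
  by rewrite !mulr1 subrK.
by rewrite -natr1; ring.
Qed.

(** The rim is homotopic to the other three sides of the polar square: the inward radius at angle 0,
    the side of radius 0, which is constant at the centre, and the outward radius at angle 1, which
    the seam identifies with the radius at angle 0. *)
Lemma boundary_null c : face l c -> cl (segment_path (face_path c) (1, 0) (1, 1)) = 1%g.
Proof.
move=> fc; have cF := face_path_continuous (R := R) fc.
rewrite -(path_class_triangle _ _ (1, 0) (0, 0) (1, 1))//.
rewrite -(path_class_triangle _ _ (0, 0) (0, 1) (1, 1))//.
have -> : cl (segment_path (face_path c) (0, 0) (0, 1)) = 1%g.
  rewrite -(path_class_cst x0 pcP (face_path c (0, 0))).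
  apply: path_class_ext; [exact: segment_path_continuous|exact: continuous_const|].
  move=> s _; rewrite /segment_path /= !mulr0 addr0; exact: face_path_center.
have -> : cl (segment_path (face_path c) (0, 1) (1, 1)) =
    cl (segment_path (face_path c) (0, 0) (1, 0)).
  apply: path_class_ext; [exact: segment_path_continuous..|].
  move=> s _; rewrite /segment_path /= !mulr0 !mulr1 !addr0 subrK.
  exact: face_path_seam.
by rewrite mul1g path_class_triangle// path_class_segment_refl.
Qed.

Lemma face_walk_prod c : face l c -> walk_prod edge_class c.1 c.2 = 1%g.
Proof.
move=> fc; have [m0|m0] := posnP (size c.2).
  by rewrite (size0nil m0).
rewrite walk_prodE -(boundary_class fc (leqnn _)) divff ?pnatr_eq0 -?lt0n//.
exact: boundary_null.
Qed.

Variable phi : X -> pi1 R x0.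
Hypothesis phiE : forall u v, adj u v -> edge_class u v = ((phi u)^-1 * phi v)%g.

Lemma boundary_potential c i : face l c -> (i <= size c.2)%N ->
  cl (segment_path (face_path c) (1, 0) (1, i%:R / (size c.2)%:R)) =
  ((phi c.1)^-1 * phi (nth c.1 (c.1 :: c.2) i))%g.
Proof.
move=> fc im; rewrite boundary_class//.
elim: i im => [_|i IH im]; first by rewrite big_ord0 /= mulVg.
rewrite big_ord_recr /= IH; last exact: ltnW.
rewrite phiE; first by rewrite -mulgA mulVKg.
by case: fc => -[pc _ _] _ _; exact: (pathP c.1 pc).
Qed.

Let star_class v := chart_class (star_contraction v) x0 pcP.
Let face_class c := chart_class (face_contraction c) x0 pcP.
(** The value of the potential at the centre of the face, carried in along the radius at angle 0. *)
Let face_center c : pi1 R x0 :=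
  (phi c.1 * cl (segment_path (face_path c) (1%R, 0%R) (0%R, 0%R)))%g.

(* The potential is transported along the characteristic map of a cell through
   the point; in that cell every contraction is a straight segment, so that
   comparing it with a chart is a triangle identity. *)
Lemma potential_point (p : P) : exists g : pi1 R x0,
  (forall v, punctured_star v p -> (g * star_class v p)%g = phi v) /\
  (forall c, face l c -> open_face c p -> (g * face_class c p)%g = face_center c).
Proof.
have [[a [b [x [ab x01 ->]]]]|[c [q [fc q1 q2 ->]]]] := complex_pointP p.
  pose F (y : R * R) : P := edge_path a b y.1.
  have cF : continuous F by apply: (continuous_compose (edge_path_continuous ab)); continuity.
  exists (phi a * cl (segment_path F (0%R, 0%R) (x, 0%R)))%g; split; last first.
    by move=> c _ /open_face_edge; case.
  move=> v Wv; have cv := chart_track_continuous (vertex_chart R l v) Wv.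
  have -> : star_class v (edge_path a b x) = cl (segment_path F (x, 0) ((v == b)%:R, 0)).
    apply: path_class_ext => //; first exact: segment_path_continuous.
    move=> s s01; rewrite star_contraction_edge ?clamp01// (clampE s01) (clampE x01).
    by rewrite /segment_path /F.
  rewrite -mulgA path_class_triangle//.
  move/(punctured_star_edge _ _ _ ab): Wv; case/orP: (ab) => [/eqP eab|adjab].
    rewrite -eab; case: (eqVneq v a) => [->|]; last by rewrite !mulr0 addr0 ltxx.
    move=> _; have -> : cl (segment_path F (0, 0) (1, 0)) = 1%g; last by rewrite mulg1.
    rewrite -(path_class_cst x0 pcP (edge_path a a 0)).
    apply: path_class_ext; [exact: segment_path_continuous|exact: continuous_const|].
    move=> s _; rewrite /segment_path /F /= -eab; apply: polygonal_complex_eq.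
    by rewrite !val_edge_path ?/lazy_adj ?eqxx// !segment_point_refl.
  case: (eqVneq v b) => [-> _|vb].
    have -> : cl (segment_path F (0, 0) (1, 0)) = edge_class a b.
      apply: path_class_ext; [exact: segment_path_continuous|exact: edge_path_continuous|].
      by move=> s _; rewrite /segment_path /F /= mulr0 mulr1 add0r.
    by rewrite phiE// mulVKg.
  case: (eqVneq v a) => [-> _|]; last by rewrite !mulr0 addr0 ltxx.
  by rewrite path_class_segment_refl// mulg1.
have cF := face_path_continuous (R := R) fc.
have c1 := clampE q1; have c2 := clampE q2.
exists (phi c.1 * cl (segment_path (face_path c) (1%R, 0%R) q))%g; split.
  move=> v Wv; have cv := chart_track_continuous (vertex_chart R l v) Wv.
  have [_ h] := (punctured_star_face v q fc).1 Wv; rewrite c2 in h.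
  have pc : path adj c.1 c.2 by case: fc => -[].
  have -> : star_class v (face_path c q) =
      cl (segment_path (face_path c) q (1, arc_end c v q.2)).
    apply: path_class_ext => //; first exact: segment_path_continuous.
    move=> s s01; rewrite star_contraction_face ?clamp01// (clampE s01) c1 c2.
    by rewrite /segment_path /= mulr1.
  rewrite -mulgA path_class_triangle//.
  have [i [im wi e]] := arc_end_vertex pc h.
  have [m0|m0] := posnP (size c.2).
    have vc : v = c.1.
      by move: wi im; rewrite m0 leqn0 => <- /eqP ->.
    have -> : cl (segment_path (face_path c) (1, 0) (1, arc_end c v q.2)) = 1%g;
      last by rewrite mulg1 vc.
    rewrite -(path_class_cst x0 pcP (edge_path c.1 c.1 0)).
    apply: path_class_ext; [exact: segment_path_continuous|exact: continuous_const|].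
    move=> s s01; rewrite /segment_path /= !mulr1 subrK mulr0 add0r.
    rewrite (@face_path_vertex _ _ _ c _ 0%N)// ?m0 ?mul0r//.
    have /andP[a0 a1] := arc_end01 pc q2 h; move/andP: s01 => [s0 s1].
    by rewrite mulr_ge0//= mulr_ile1.
  have -> : arc_end c v q.2 = i%:R / (size c.2)%:R.
    by rewrite -e mulrAC divff ?mul1r// pnatr_eq0 -lt0n.
  by rewrite boundary_potential// wi mulVKg.
move=> c' fc' Wc; have cv := chart_track_continuous (face_chart R fc') Wc.
have [e lt1] := (open_face_path c' q fc).1 Wc; subst c'.
have -> : face_class c (face_path c q) =
    cl (segment_path (face_path c) q (0, q.2)).
  apply: path_class_ext => //; first exact: segment_path_continuous.
  move=> s s01; rewrite face_contractionE ?clamp01// (clampE s01) c1.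
  by rewrite /segment_path /= mulr0 addr0 -mulrDl subrK mul1r.
rewrite -mulgA path_class_triangle// /face_center; congr (_ * _)%g.
rewrite -(path_class_triangle _ _ (1, 0) (0, 0) (0, q.2))//.
have -> : cl (segment_path (face_path c) (0, 0) (0, q.2)) = 1%g; last by rewrite mulg1.
rewrite -(path_class_cst x0 pcP (face_path c (0, 0))).
apply: path_class_ext; [exact: segment_path_continuous|exact: continuous_const|].
move=> s _; rewrite /segment_path /= !mulr0 addr0; exact: face_path_center.
Qed.

Lemma chart_cover (p : P) : (exists v, punctured_star v p) \/
  (exists c, face l c /\ open_face c p).
Proof.
have [v sv] := star_cover p.
have [[a [b [x [ab _ e]]]]|[c [q [fc q1 q2 e]]]] := complex_pointP p.
  left; exists v; move: sv; rewrite e.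
  by rewrite /star /punctured_star /= val_edge_path.
have [lt1|ge1] := ltP (clamp q.1) 1.
  by right; exists c; split=> //; rewrite e; apply/open_face_path.
left; exists v; move: sv; rewrite e /star /punctured_star /= val_face_path//.
rewrite /face_map ltNge ge1 attach_hat//; exact: clamp01.
Qed.

(** On a chart, [Phi p] times the class of the track of [p] does not depend on [p], so
    [chart_path_class] yields a coboundary of [Phi]; [path_class_potential] passes from charts to
    all paths. *)
Lemma all_paths_potential : exists Phi : P -> pi1 R x0,
  forall g : R -> P, continuous g -> cl g = ((Phi (g 0%R))^-1 * Phi (g 1%R))%g.
Proof.
have /choice[Phi PhiP] := potential_point.
exists Phi => g cg; apply: (path_class_potential (Phi := Phi)) cg => p.
have [[v Wv]|[c [fc Wc]]] := chart_cover p.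
  have ch := vertex_chart R l v.
  exists (punctured_star v); split=> //; first exact: chart_open ch.
  move=> a ca Wa; rewrite (chart_path_class ch x0 pcP ca Wa).
  have e s : chart_class (star_contraction v) x0 pcP (a s) = ((Phi (a s))^-1 * phi v)%g.
    by rewrite -((PhiP (a s)).1 v (Wa s)) mulKg.
  by rewrite !e invgM invgK -mulgA mulVKg.
have ch := face_chart R fc.
exists (open_face c); split=> //; first exact: chart_open ch.
move=> a ca Wa; rewrite (chart_path_class ch x0 pcP ca Wa).
have e s : chart_class (face_contraction c) x0 pcP (a s) =
    ((Phi (a s))^-1 * face_center c)%g.
  by rewrite -((PhiP (a s)).2 c fc (Wa s)) mulKg.
by rewrite !e invgM invgK -mulgA mulVKg.
Qed.

Lemma potential_simply_connected : k_simply_connected R l X.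
Proof.
split=> [p q|g cg g01].
  have [a [ca a0 a1]] := pcP p q; exists a; split=> //.
  exact: continuous_subspaceT.
have cgc : continuous (fun s => g (clamp s)).
  apply: (within_continuous_clamp (A := `[0, 1]%classic : set R) (f := g)
    (c := @clamp R)) => //.
    exact: clamp_continuous.
  by move=> s; rewrite /= in_itv/=; exact: clamp01.
have [Phi PhiP] := all_paths_potential.
have c1 : cl (fun s => g (clamp s)) = 1%g.
  by rewrite PhiP// clamp0 clamp1 g01 mulVg.
have [|H [cH H0 H1 He]] := path_class_null cgc _ c1; first by rewrite clamp0 clamp1.
exists H; split=> [|s s01|s s01|t t01].
- exact: continuous_subspaceT.
- by rewrite H0 clampK clampE.
- by rewrite H1 clamp0.
- by have [-> ->] := He t; rewrite clamp0 clamp1 g01.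
Qed.
End SimplyConnected.

(** * The coarse covering theorem *)

Section GraphSequences.
Variable Y : sgraph.
Hypothesis cY : graph_connected Y.

Lemma gdist_splitD m n (y y' : Y) : (gdist y y' <= m + n)%N ->
  exists z, (gdist y z <= m)%N /\ (gdist z y' <= n)%N.
Proof.
elim: n y' => [|n IH] y'; first by rewrite addn0 => d; exists y'; rewrite gdistxx.
rewrite addnS => /(gdist_split cY)[z1 d1 d2]; have [z [dz dz1]] := IH _ d1.
exists z; split=> //; apply: leq_trans (gdist_triangle cY z1 _ _) _.
by rewrite -[X in (_ <= X)%N]addn1 leq_add.
Qed.
End GraphSequences.

Section CoarseCovering.
Variables (R : realType) (X Y : sgraph) (f : X -> Y) (C C' K k r : nat).
Hypotheses (cX : graph_connected X) (cY : graph_connected Y).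
Hypotheses (C0 : (0 < C)%N) (C'0 : (0 < C')%N) (k0 : (0 < k)%N).
Hypothesis scY : k_simply_connected R k Y.
(** [D] is the step bound of [coarse_filling]. [l] is twice the sum of two distances [D.+1 * C'],
    which is what [geodesic_prodM] requires to serve as [gamM]. *)
Let D := (2 * k + C).+1.
Let l := (4 * (D.+1 * C'))%N.
Hypothesis rD : (5 * D * C' <= r)%N.
Hypothesis lift : forall x y, (gdist (f x) y <= K + C)%N ->
  exists x', (gdist x x' <= r)%N /\ (gdist (f x') y <= K)%N.
Hypothesis lipschitz : forall x x', adj x x' -> (gdist (f x) (f x') <= C)%N.
Hypothesis local_inj : forall x x', (gdist x x' <= r)%N ->
  (gdist (f x) (f x') <= C + 2 * K)%N -> (gdist x x' <= C')%N.

Local Notation lies_over := (lies_over f K).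

Lemma lipschitz_lazy x x' : lazy_adj x x' -> (gdist (f x) (f x') <= C)%N.
Proof. by case/orP => [/eqP ->|]; [rewrite gdistxx|exact: lipschitz]. Qed.

Lemma gdist_image x x' : (gdist (f x) (f x') <= gdist x x' * C)%N.
Proof.
have [z [z0 zn zl]] := walk_nth (gdist_walk cX x x').
move: (gdist x x') zn => n zn; rewrite -z0 -(zn n (leqnn n)) -[X in (_ <= X * _)%N]subn0.
by apply: (gdist_seq cY (z := fun i => f (z i))) => // i _; exact: lipschitz_lazy.
Qed.

Lemma over_image x : lies_over x (f x).
Proof. by rewrite /lies_over gdistxx. Qed.

Lemma lift_sequence q x y y' : lies_over x y -> (gdist y y' <= q * C)%N ->
  exists (u : nat -> Y) (w : nat -> X), [/\ u 0%N = y, w 0%N = x, u q = y' &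
    (forall i, (i <= q)%N -> lies_over (w i) (u i)) /\
    forall i, (i < q)%N -> (gdist (u i) (u i.+1) <= C)%N /\
                          (gdist (w i) (w i.+1) <= C')%N].
Proof.
elim: q y' => [|q IH] y' oxy.
  rewrite mul0n leqn0 => /eqP d; exists (fun=> y), (fun=> x); split=> //.
  have [p [_ lp sp]] := gdist_walk cY y y'.
  by move: sp lp; rewrite d => /size0nil -> /=.
rewrite mulSn addnC => /(gdist_splitD cY)[y1 [d1 d2]].
have [u [w [u0 w0 uq [ov st]]]] := IH _ oxy d1.
have o1 : lies_over (w q) y1 by rewrite -uq; exact: ov.
have [x' [dx ox]] := over_step cY (leqnn _) lift local_inj o1 d2.
exists (fun i => if (i <= q)%N then u i else y'),
  (fun i => if (i <= q)%N then w i else x').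
rewrite ltnn; split=> //; split=> i.
  by case: ifP => // iq _; exact: ov.
rewrite ltnS => iq; rewrite iq; have [iq'|qi] := ltnP i q; first exact: st.
have -> : i = q by apply/eqP; rewrite eqn_leq iq.
by rewrite uq.
Qed.

Section Monodromy.
Variables (G : groupType) (gam : X -> X -> G).
Hypothesis gam1 : forall x, gam x x = 1%g.
Hypothesis gamM : forall x y z, (gdist x y <= D.+1 * C')%N ->
  (gdist y z <= D.+1 * C')%N -> (gam x y * gam y z = gam x z)%g.

Lemma monodromy (y : nat -> Y) (x : nat -> X) (T : nat) : (0 < T)%N -> y T = y 0%N ->
  (forall i, (i < T)%N -> (gdist (y i) (y i.+1) <= C)%N) ->
  (forall i, (i <= T)%N -> lies_over (x i) (y i)) ->
  (forall i, (i < T)%N -> (gdist (x i) (x i.+1) <= C')%N) ->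
  (gdist (x 0%N) (x T) <= C')%N /\
  (\prod_(i < T) gam (x i) (x i.+1))%g = gam (x 0%N) (x T).
Proof.
move=> T0 yT yC ov xC.
have [M [m [v [M0 [vB vS vH vV]]]]] := coarse_filling cY k0 C0 scY T0 yT yC.
exact: (filling_monodromy cX cY C0 C'0 (ltn0Sn _) (leqnn _) rD lift local_inj gam1 gamM
  T0 M0 yT ov xC vB vS vH vV).
Qed.

End Monodromy.

(** The image of a geodesic from [x] to [x'] is closed up by [q] steps from [f x'] back to [f x],
    whose lift [w] starts at [x']. Trivial monodromy puts the end of [w] within [C'] of [x], and
    that end is within [q * C'] of [x']. *)
Lemma gdist_preimage q x x' : (gdist (f x) (f x') <= q * C)%N ->
  (gdist x x' <= C' + q * C')%N.
Proof.
rewrite (gdistC cY) => d.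
have [u [w [u0 w0 uq [ov st]]]] := lift_sequence (over_image x') d.
have [p0|p0] := posnP (gdist x x'); first by rewrite p0.
have [z [z0 zn zl]] := walk_nth (gdist_walk cX x x').
set p := gdist x x' in p0 zn *.
pose xs i := if (i <= p)%N then z i else w (i - p)%N.
pose ys i := if (i <= p)%N then f (z i) else u (i - p)%N.
have xsp i : xs (p + i)%N = w i.
  rewrite /xs; case: i => [|i]; first by rewrite addn0 leqnn zn.
  by rewrite addnS ltnNge leq_addr /= -addnS addKn.
have ysp i : ys (p + i)%N = u i.
  rewrite /ys; case: i => [|i]; first by rewrite addn0 leqnn zn.
  by rewrite addnS ltnNge leq_addr /= -addnS addKn.
(* Only the distance estimate is used, so the group is irrelevant. *)
have [| | | | | | |h _] :=
  @monodromy (pi1 R (0 : R)) (fun _ _ => 1%g) _ _ ys xs (p + q)%N.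
- by [].
- by move=> *; rewrite mulg1.
- by rewrite addn_gt0 p0.
- by rewrite ysp uq /ys z0.
- move=> i iT; have [ip|pi] := ltnP i p.
    by rewrite /ys ip (ltnW ip); exact: lipschitz_lazy.
  rewrite -(subnKC pi) -addnS !ysp; have := st (i - p)%N.
  by case=> //; rewrite ltn_subLR.
- move=> i iT; have [ip|/ltnW pi] := leqP i p.
    by rewrite /xs /ys ip; exact: over_image.
  by rewrite -(subnKC pi) xsp ysp; apply: ov; rewrite leq_subLR.
- move=> i iT; have [ip|pi] := ltnP i p.
    rewrite /xs ip (ltnW ip); apply: leq_trans C'0.
    exact: gdist_lazy.
  rewrite -(subnKC pi) -addnS !xsp; have := st (i - p)%N.
  by case=> //; rewrite ltn_subLR.
move: h; rewrite xsp {1}/xs /= z0 => h.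
apply: leq_trans (gdist_triangle cX (w q) _ _) _; apply: leq_add => //.
rewrite (gdistC cX) -w0 -[X in (_ <= X * _)%N]subn0.
by apply: (gdist_seq cX) => // i /andP[_ iq]; exact: (st i iq).2.
Qed.

(** [monodromy] is applied to the image of a closed walk, with the walk itself as lift and geodesic
    products of edge classes as [gam]; the total product is [gam x x], which is trivial. *)
Lemma domain_simply_connected : (exists x : X, True) -> k_simply_connected R l X.
Proof.
move=> [x0 _].
have pcP := @polygonal_path_connected R l X cX.
pose p0 : polygonal_complex R l X := edge_path x0 x0 0.
pose e := edge_class p0 pcP.
have face1 (c : loop X) : face l c -> walk_prod e c.1 c.2 = 1%g by exact: face_walk_prod.
have closed x p : path adj x p -> last x p = x -> walk_prod e x p = 1%g.
  move=> xp lp; have [T0|T0] := posnP (size p); first by rewrite (size0nil T0).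
  have [||||||_] := @monodromy _ (geodesic_prod e cX) _ _
      (fun i => f (nth x (x :: p) i)) (fun i => nth x (x :: p) i) (size p) T0.
  - by move=> z; exact: geodesic_prod1.
  - move=> a b c ab bc; apply: (geodesic_prodM face1).
    by rewrite /l; lia.
  - by rewrite -(last_nth x) lp.
  - by move=> i ip; apply: lipschitz; exact: (pathP x xp).
  - by move=> i _; exact: over_image.
  - move=> i ip; apply: leq_trans C'0; apply: gdist_le; apply: walk_adj.
    exact: (pathP x xp).
  rewrite -(last_nth x) lp geodesic_prod1 => <-.
  rewrite walk_prodE; apply: eq_bigr => i _; symmetry.
  apply: (geodesic_prod_adj face1); first by rewrite /l; lia.
  exact: (pathP x xp).
have [phi phiE] := closed_walk_potential x0 cX closed.
exact: (potential_simply_connected phiE).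
Qed.
End CoarseCovering.

Theorem theorem5p7 (R : realType) :
  exists R0 R' L : nat -> nat -> nat -> nat,
  forall C C' K k : nat,
  (0 < C)%N -> (0 < C')%N -> (0 < K)%N -> (0 < k)%N ->
  [/\ (0 < R0 C C' k)%N, (0 < R' C K k)%N &
    forall (X Y : sgraph) (f : X -> Y) (r : nat),
    (exists x : X, True) -> (exists y : Y, True) ->
    graph_connected X -> graph_connected Y ->
    k_simply_connected R k Y ->
    (R0 C C' k <= r)%N ->
    (forall (x : X) (y : Y), (gdist (f x) y <= R' C K k)%N ->
       exists x' : X, (gdist x x')%:R <= r%:R / 2 :> R /\
                      (gdist (f x') y <= K)%N) ->
    (forall x x' : X, adj x x' -> (gdist (f x) (f x') <= C)%N) ->
    (forall x x' : X, (gdist x x' <= r)%N ->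
       (gdist (f x) (f x') <= C + 2 * K)%N -> (gdist x x' <= C')%N) ->
    quasi_isometry (fun x x' : X => (gdist x x')%:R)
                   (fun y y' : Y => (gdist y y')%:R)
                   (Num.max C%:R (C'%:R / C%:R : R)) (Num.max C'%:R K%:R) f /\
    exists l : nat, (0 < l <= L C C' k)%N /\ k_simply_connected R l X].
Proof.
(* With [D = 2 * k + C + 1] the outer two are [5 * D * C'] and [4 * D.+1 * C']. The middle one is
   [K + C] because a point over [y] maps [K]-close to [y], and [over_step] moves [y] by at most
   [C]. *)
exists (fun C C' k => 5 * (2 * k + C).+1 * C')%N, (fun C K _ => K + C)%N,
  (fun C C' k => 4 * ((2 * k + C).+2 * C'))%N.
move=> C C' K k C0 C'0 K0 k0; split; [by rewrite !muln_gt0 C'0|by rewrite addn_gt0 K0|].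
move=> X Y f r X0 Y0 cX cY scY rD lift lipschitz local_inj.
have lift' x y : (gdist (f x) y <= K + C)%N ->
    exists x', (gdist x x' <= r)%N /\ (gdist (f x') y <= K)%N.
  move=> /lift[x' [d h]]; exists x'; split=> //.
  rewrite -(ler_nat R); apply: le_trans d _.
  by rewrite ler_pdivrMr// ler_peMr// ler1n.
split; last first.
  exists (4 * ((2 * k + C).+2 * C'))%N; split; first by rewrite leqnn andbT !muln_gt0 C'0.
  exact: (domain_simply_connected cX cY C0 C'0 k0 scY rD lift' lipschitz local_inj).
set A := Num.max _ _; set B := Num.max _ _.
have CR : 0 < C%:R :> R by rewrite ltr0n.
have C1 : 1 <= C%:R :> R by rewrite ler1n.
have C'1 : 1 <= C'%:R :> R by rewrite ler1n.
have AC : C%:R <= A by rewrite le_max lexx.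
have AC' : C'%:R / C%:R <= A by rewrite le_max lexx orbT.
have BC' : C'%:R <= B by rewrite le_max lexx.
have BK : K%:R <= B by rewrite le_max lexx orbT.
have A0 : 0 < A by exact: lt_le_trans AC.
split=> [x x'|y]; last first.
  (* Any starting point will do: it is transported along a geodesic from its image to [y], and the
     number of steps does not affect the final bound [K]. *)
  have [x _] := X0.
  have [x' [_ h]] := over_transport cX cY C0 (leqnn (K + C)) lift' local_inj
    (over_image f K x) (leqnn (gdist (f x) y)).
  by exists x'; apply: le_trans BK; rewrite ler_nat (gdistC cY).
apply/andP; split; last first.
  apply: (@le_trans _ _ (C%:R * (gdist x x')%:R)).
    by rewrite mulrC -natrM ler_nat; exact: gdist_image.
  apply: (@le_trans _ _ (A * (gdist x x')%:R)); first by rewrite ler_wpM2r.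
  by rewrite lerDl; apply: le_trans BC'.
set n := gdist (f x) (f x').
rewrite lerBlDr mulrC ler_pdivrMr//.
have pre q : (n <= q * C)%N -> (gdist x x')%:R <= C'%:R + q%:R * C'%:R :> R.
  move=> h; rewrite -natrM -natrD ler_nat.
  exact: (gdist_preimage cX cY C0 C'0 k0 scY rD lift' lipschitz local_inj).
(* Taking for [q] the floor of [n / C] plus one costs an extra [C']; the constant [2 * C'] fits
   under [A * B] because [A >= C >= 2]. For [C = 1] this can fail, but then [q = n] is exact. *)
have [C_1|C_2] := leqP C 1.
  have eC : C = 1%N by lia.
  have {}pre := pre n; rewrite eC muln1 in pre.
  apply: le_trans (pre (leqnn _)) _; rewrite eC divr1 in AC'.
  rewrite addrC mulrDl; apply: lerD; first by rewrite ler_wpM2l.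
  by apply: le_trans AC' _; rewrite ler_peMl ?(ltW A0)//; exact: le_trans BC'.
apply: le_trans (pre (n %/ C).+1 _) _; first by rewrite ltnW// ltn_ceil.
have C2 : 2 <= C%:R :> R by rewrite (ler_nat _ 2).
have h1 : (n %/ C)%:R * C'%:R <= n%:R * A.
  apply: (@le_trans _ _ (n%:R * (C'%:R / C%:R))); last by rewrite ler_wpM2l.
  rewrite mulrCA mulrC ler_wpM2l// ler_pdivlMr// -natrM ler_nat.
  exact: leq_trunc_div.
have h2 : 2 * C'%:R <= A * B.
  by apply: ler_pM => //; exact: le_trans AC.
rewrite -natr1; lra.
Qed.
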